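(* Let $\Pi$ be a smooth irreducible $E$-linear representation of $\mathrm{B}$ which admits a central character. Then there exist smooth characters $\sigma_1,\sigma_2:\mathbf{Q}_p^\times\to E^\times$ such that, with $\sigma=\sigma_1\otimes\sigma_2$, the representation $\Pi$ is a quotient of $\operatorname{ind}_{\mathrm{K}\mathrm{Z}}^{\mathrm{B}}\sigma$.
   Context: $p$ is a prime and $E$ is a finite extension of $\mathbf{F}_p$. $\mathrm{B}$ is the group of invertible upper triangular $2\times 2$ matrices with entries in $\mathbf{Q}_p$, $\mathrm{K}=\left\{\begin{pmatrix} a & b\\ 0 & d\end{pmatrix}: a,d\in\mathbf{Z}_p^\times,\ b\in\mathbf{Z}_p\right\}$ and $\mathrm{Z}\simeq\mathbf{Q}_p^\times$ is the center of $\mathrm{B}$ (scalar matrices). For smooth characters $\sigma_1,\sigma_2:\mathbf{Q}_p^\times\to E^\times$, $\sigma=\sigma_1\otimes\sigma_2$ is the character $\begin{pmatrix} a & b\\ 0 & d\end{pmatrix}\mapsto \sigma_1(a)\sigma_2(d)$ of $\mathrm{K}\mathrm{Z}$, and $\operatorname{ind}_{\mathrm{K}\mathrm{Z}}^{\mathrm{B}}\sigma$ is the space of functions $f:\mathrm{B}\to E$ with $f(kg)=\sigma(k)f(g)$ for $k\in\mathrm{K}\mathrm{Z}$, compactly supported modulo $\mathrm{Z}$, with $\mathrm{B}$ acting by $(gf)(h)=f(hg)$. *)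

(* Defs.v *)
From HB Require Import structures.
From mathcomp Require Import all_boot all_order all_algebra all_field.
From mathcomp Require Import all_classical all_reals all_analysis.
From mathcomp Require Import ring.

Set Implicit Arguments.
Unset Strict Implicit.
Unset Printing Implicit Defensive.

Import GRing.Theory.

Local Open Scope nat_scope.

(* Z_p is the inverse limit of the Z/p^n; the n-th component of an element is *)
(* stored as the representative in [0, p^n[ of its class modulo p^n.          *)
Record padic_seq (p : nat) := PadicSeq {
  padic_res :> nat -> nat;
  padic_resP : forall n, padic_res n.+1 %% p ^ n = padic_res n }.

Definition padic_int (p : nat) (p_pr : prime p) : Type := padic_seq p.

Section PadicInt.
Variables (p : nat) (p_pr : prime p).
Local Notation Zp := (padic_int p_pr).
Implicit Types x y z : Zp.

Lemma padic_ext x y : (forall n, x n = y n) -> x = y.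
Proof.
case: x y => [f fP] [g gP] /= /funext fg; case: _ / fg in gP *.
by congr PadicSeq; apply: Prop_irrelevance.
Qed.

Let pX_gt0 n : 0 < p ^ n. Proof. by rewrite expn_gt0 prime_gt0. Qed.

Lemma padic_res_modn x n m : n <= m -> x m %% p ^ n = x n.
Proof.
elim: m => [|m IH]; first by rewrite leqn0 => /eqP ->; rewrite -(padic_resP x) modn_mod.
rewrite leq_eqVlt => /predU1P[->|]; first by rewrite -(padic_resP x) modn_mod.
by rewrite ltnS => nm; rewrite -(IH nm) -(padic_resP x m) modn_dvdm// dvdn_exp2l.
Qed.

Lemma padic_res_small x n : x n %% p ^ n = x n.
Proof. exact: padic_res_modn. Qed.

Lemma padic_res_lt x n : x n < p ^ n.
Proof. by rewrite -padic_res_small ltn_mod. Qed.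

Definition padic_mk (f : nat -> nat)
    (fP : forall n, f n.+1 = f n %[mod p ^ n]) : Zp.
Proof.
exists (fun n => f n %% p ^ n) => n.
by rewrite modn_dvdm ?fP// dvdn_exp2l.
Defined.

Definition padic_zero : Zp := @padic_mk (fun=> 0) (fun=> erefl).
Definition padic_one : Zp := @padic_mk (fun=> 1) (fun=> erefl).

Fact padic_add_subproof x y n : x n.+1 + y n.+1 = x n + y n %[mod p ^ n].
Proof. by rewrite -modnDm !padic_resP. Qed.
Definition padic_add x y : Zp :=
  @padic_mk (fun n => x n + y n) (padic_add_subproof x y).

Fact padic_mul_subproof x y n : x n.+1 * y n.+1 = x n * y n %[mod p ^ n].
Proof. by rewrite -modnMm !padic_resP. Qed.
Definition padic_mul x y : Zp :=
  @padic_mk (fun n => x n * y n) (padic_mul_subproof x y).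

Fact padic_opp_subproof x n : p ^ n.+1 - x n.+1 = p ^ n - x n %[mod p ^ n].
Proof.
apply/eqP; rewrite -(eqn_modDr (x n.+1)) subnK 1?ltnW ?padic_res_lt//.
rewrite -(modnDmr _ (x n.+1)) padic_resP subnK 1?ltnW ?padic_res_lt//.
by rewrite expnS modnMl modnn.
Qed.
Definition padic_opp x : Zp :=
  @padic_mk (fun n => p ^ n - x n) (padic_opp_subproof x).

Fact padic_addA : associative padic_add.
Proof. by move=> x y z; apply: padic_ext => n /=; rewrite modnDml modnDmr addnA. Qed.
Fact padic_addC : commutative padic_add.
Proof. by move=> x y; apply: padic_ext => n /=; rewrite addnC. Qed.
Fact padic_add0 : left_id padic_zero padic_add.
Proof. by move=> x; apply: padic_ext => n /=; rewrite modnDml padic_res_small. Qed.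
Fact padic_addN : left_inverse padic_zero padic_opp padic_add.
Proof.
move=> x; apply: padic_ext => n /=.
by rewrite modnDml subnK ?modnn ?mod0n// ltnW ?padic_res_lt.
Qed.
Fact padic_mulA : associative padic_mul.
Proof. by move=> x y z; apply: padic_ext => n /=; rewrite modnMml modnMmr mulnA. Qed.
Fact padic_mulC : commutative padic_mul.
Proof. by move=> x y; apply: padic_ext => n /=; rewrite mulnC. Qed.
Fact padic_mul1 : left_id padic_one padic_mul.
Proof. by move=> x; apply: padic_ext => n /=; rewrite modnMml mul1n padic_res_small. Qed.
Fact padic_mulDl : left_distributive padic_mul padic_add.
Proof.
move=> x y z; apply: padic_ext => n /=.
by rewrite modnMml mulnDl modnDm.
Qed.
Fact padic_one_neq0 : padic_one <> padic_zero.
Proof.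
move/(congr1 (fun x : Zp => x 1)) => /=.
by rewrite expn1 modn_small ?mod0n// prime_gt1.
Qed.

HB.instance Definition _ := gen_eqMixin Zp.
HB.instance Definition _ := gen_choiceMixin Zp.
HB.instance Definition _ := GRing.isZmodule.Build Zp
  padic_addA padic_addC padic_add0 padic_addN.
Fact padic_oner_neq0 : padic_one != 0%R.
Proof. exact/eqP/padic_one_neq0. Qed.
HB.instance Definition _ := GRing.Zmodule_isComNzRing.Build Zp
  padic_mulA padic_mulC padic_mul1 padic_mulDl padic_oner_neq0.

Local Open Scope ring_scope.

Definition padic_unit : {pred Zp} := [pred x | `[< exists y, y * x = 1 >]].
Definition padic_inv x : Zp :=
  if pselect (exists y, y * x = 1) is left e then sval (cid e) else x.

Fact padic_mulVx : {in padic_unit, left_inverse 1 padic_inv *%R}.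
Proof.
move=> x /asboolP xu; rewrite /padic_inv.
by case: pselect => // e; case: (cid e).
Qed.
Fact padic_unitP x y : y * x = 1 -> x \in padic_unit.
Proof. by move=> yx; apply/asboolP; exists y. Qed.
Fact padic_inv_out : {in [predC padic_unit], padic_inv =1 id}.
Proof.
move=> x /negP xu; rewrite /padic_inv.
by case: pselect => // e; case: xu; apply/asboolP.
Qed.

HB.instance Definition _ := GRing.ComNzRing_hasMulInverse.Build Zp
  padic_mulVx padic_unitP padic_inv_out.

Fact padic_idomain : GRing.integral_domain_axiom Zp.
Proof.
move=> x y xy0.
have neq0E (z : Zp) : z != 0 -> exists n, z n != 0%N.
  move=> /eqP z0; apply: contrapT => zn; apply: z0; apply: padic_ext => n /=.
  by rewrite mod0n; apply/eqP; apply: contrapT => /negP h; apply: zn; exists n.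
apply/orP; have [|/neq0E[n xn]] := eqVneq x 0; [by left|right].
apply/negPn/negP => /neq0E[m ym].
have := congr1 (fun x : Zp => x (n + m)%N) xy0 => /=; rewrite mod0n.
have logn_lt (z : Zp) k l : z k != 0%N -> (k <= l)%N ->
    (0 < z l)%N /\ (logn p (z l) < k)%N.
  move=> zk kl; have zl : (0 < z l)%N.
    by rewrite lt0n; apply: contraNneq zk => zl; rewrite -(padic_res_modn z kl) zl mod0n.
  split=> //; rewrite ltnNge; apply: contraNN zk.
  by rewrite -(padic_res_modn z kl) -pfactor_dvdn.
have [xgt0 xlt] := logn_lt x n _ xn (leq_addr m n).
have [ygt0 ylt] := logn_lt y m _ ym (leq_addl n m).
move/eqP; rewrite -/(dvdn _ _) pfactor_dvdn ?muln_gt0 ?xgt0// lognM// leqNgt.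
by rewrite -addnS leq_add// ltnW.
Qed.
HB.instance Definition _ := GRing.ComUnitRing_isIntegral.Build Zp padic_idomain.

End PadicInt.

Section PadicIntTheory.
Variables (p : nat) (p_pr : prime p).
Local Notation Zp := (padic_int p_pr).
Implicit Types x y z : Zp.

Local Open Scope ring_scope.

Lemma padic_resD x y n : (x + y : Zp) n = ((x n + y n) %% p ^ n)%N.
Proof. by []. Qed.
Lemma padic_resM x y n : (x * y : Zp) n = ((x n * y n) %% p ^ n)%N.
Proof. by []. Qed.
Lemma padic_res_nat k n : (k%:R : Zp) n = (k %% p ^ n)%N.
Proof.
elim: k => [//|k IH]; rewrite mulrS padic_resD IH.
by rewrite -modnDml modn_mod modnDml modnDmr add1n.
Qed.

Lemma padic_dvd_pX (d : Zp) : d != 0 -> exists k (e : Zp), d * e = p%:R ^+ k.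
Proof.
move=> /eqP d0; have [n /eqP dn] : exists n, d n <> 0%N.
  apply: contrapT => dn; apply: d0; apply: padic_ext => n /=.
  by rewrite mod0n; apply: contrapT => h; apply: dn; exists n.
have dm0 m : (0 < d (m + n))%N.
  rewrite lt0n; apply: contraNneq dn => dm.
  by rewrite -(padic_res_modn d (leq_addl m n)) dm mod0n.
pose v := logn p (d n).
have vlog k m : (k <= n)%N -> (p ^ k %| d (m + n))%N = (p ^ k %| d n)%N.
  move=> kn; rewrite -(padic_res_modn d (leq_addl m n)).
  by rewrite /dvdn modn_dvdm ?dvdn_exp2l.
have dn0 : (0 < d n)%N by rewrite lt0n.
have vn : (v < n)%N.
  rewrite ltnNge -pfactor_dvdn//; apply: contraNN dn => /eqP h.
  by rewrite -(padic_res_small d n) h.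
have vdvd m : (p ^ v %| d (m + n))%N by rewrite vlog ?(ltnW vn)// pfactor_dvdn.
pose u m := (d (m + n) %/ p ^ v)%N.
have uE m : (u m * p ^ v = d (m + n))%N by rewrite /u divnK.
have pv0 : (0 < p ^ v)%N by rewrite expn_gt0 prime_gt0.
have ucop m k : coprime (u m) (p ^ k).
  apply: coprimeXr; rewrite coprime_sym prime_coprime//; apply/negP => pu.
  have : (p ^ v.+1 %| d n)%N by rewrite -(vlog _ m)// -uE expnS dvdn_mul.
  by rewrite pfactor_dvdn// ltnn.
have ucompat m : u m.+1 = u m %[mod p ^ m].
  apply/eqP; have le : (p ^ m <= p ^ (m + n - v))%N.
    by rewrite leq_exp2l ?prime_gt1// -addnBA ?leq_addr// ltnW.
  have dv : (p ^ m %| p ^ (m + n - v))%N.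
    by rewrite dvdn_exp2l// -addnBA ?leq_addr// ltnW.
  rewrite -(modn_dvdm (u m.+1) dv) -(modn_dvdm (u m) dv).
  suff -> : (u m.+1 %% p ^ (m + n - v) = u m %% p ^ (m + n - v))%N by [].
  apply/eqP; rewrite -(eqn_pmul2r pv0) !muln_modl -expnD subnK; last first.
    by rewrite (leq_trans (ltnW vn)) ?leq_addl.
  by rewrite !uE addSn padic_resP padic_res_small.
have uinv m : exists a, a * u m = 1 %[mod p ^ m].
  have um0 : (0 < u m)%N by move: (dm0 m); rewrite -uE muln_gt0 => /andP[].
  exists (egcdn (u m) (p ^ m)).1.
  case: egcdnP => //= a b -> _; rewrite (eqP (ucop m m)).
  by rewrite modnMDl.
have [e eE] := choice uinv.
have ecompat m : e m.+1 = e m %[mod p ^ m].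
  have e1 : (e m.+1 * u m = 1 %[mod p ^ m])%N.
    rewrite -modnMmr -ucompat modnMmr.
    have dv : (p ^ m %| p ^ m.+1)%N by rewrite dvdn_exp2l.
    by rewrite -(modn_dvdm _ dv) eE (modn_dvdm _ dv).
  rewrite -[e m.+1 in LHS]muln1 -modnMmr -(eE m) modnMmr mulnA mulnAC mulnC.
  by rewrite -modnMmr e1 modnMmr muln1.
exists v, (padic_mk p_pr ecompat); apply: padic_ext => m.
rewrite -natrX padic_res_nat padic_resM /=.
rewrite -(padic_res_modn d (leq_addr n m)) -modnMm !modn_mod modnMm -uE.
by rewrite mulnC mulnA -modnMml eE modnMml mul1n.
Qed.

End PadicIntTheory.

Local Open Scope ring_scope.

Lemma fractionE (R : idomainType) (x : {fraction R}) :
  exists a b : R, b != 0 /\ x * FracField.tofrac b = FracField.tofrac a.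
Proof.
elim/quotW: x => r; exists (frac r).1, (frac r).2; split; first exact: denom_ratioP.
unlock FracField.tofrac; rewrite -[LHS]FracField.pi_mul /FracField.mulf.
apply/eqmodP; rewrite /= FracField.equivfE.
by rewrite !numden_Ratio ?mulr1 ?oner_neq0 ?mulf_neq0 ?denom_ratioP// mulrC.
Qed.

Local Open Scope classical_set_scope.

Definition padic (p : nat) (p_pr : prime p) : Type :=
  {fraction (padic_int p_pr)}.
HB.instance Definition _ p (p_pr : prime p) := GRing.Field.on (padic p_pr).

Definition padic_of_int p (p_pr : prime p) : padic_int p_pr -> padic p_pr :=
  @FracField.tofrac (padic_int p_pr).
HB.instance Definition _ p (p_pr : prime p) :=
  GRing.RMorphism.copy (@padic_of_int p p_pr)
    (@FracField.tofrac (padic_int p_pr)).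

Section PadicTopology.
Variables (p : nat) (p_pr : prime p).
Local Notation Zp := (padic_int p_pr).
Local Notation Qp := (padic p_pr).
Implicit Types x y z : Qp.

(* The subgroup p^n Z_p of Q_p. The cosets x + p^n Z_p are the basic          *)
(* neighbourhoods of x (see padic_nbhsP).                                     *)
Definition padic_lattice (n : nat) : set Qp :=
  range (fun z : Zp => p%:R ^+ n * padic_of_int z).

Definition padic_ent : set_system (Qp * Qp) :=
  filter_from [set: nat] (fun n => [set xy | padic_lattice n (xy.2 - xy.1)]).

Lemma padic_lattice0 n : padic_lattice n 0.
Proof. by exists 0 => //; rewrite rmorph0 mulr0. Qed.
Lemma padic_latticeD n x y :
  padic_lattice n x -> padic_lattice n y -> padic_lattice n (x + y).
Proof. by move=> [a _ <-] [b _ <-]; exists (a + b) => //; rewrite rmorphD mulrDr. Qed.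
Lemma padic_latticeN n x : padic_lattice n x -> padic_lattice n (- x).
Proof. by move=> [a _ <-]; exists (- a) => //; rewrite rmorphN mulrN. Qed.
Lemma padic_lattice_le n m x :
  (m <= n)%N -> padic_lattice n x -> padic_lattice m x.
Proof.
move=> mn [a _ <-]; exists (p%:R ^+ (n - m) * a) => //.
by rewrite rmorphM rmorphXn rmorph_nat mulrA -exprD subnKC.
Qed.

Fact padic_ent_filter : Filter padic_ent.
Proof.
apply: filter_from_filter => [|n m _ _]; first by exists 0%N.
by exists (maxn n m) => // xy h; split; apply: padic_lattice_le h;
  rewrite ?leq_maxl ?leq_maxr.
Qed.
Fact padic_ent_refl A : padic_ent A -> diagonal `<=` A.
Proof.
by move=> [n _ nA] xy /diagonalP xyE; apply: nA; rewrite /= xyE subrr; exact: padic_lattice0.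
Qed.
Fact padic_ent_inv A : padic_ent A -> padic_ent (A^-1)%relation.
Proof.
move=> [n _ nA]; exists n => // -[x y] /= /padic_latticeN h.
by apply: nA; rewrite /= -opprB.
Qed.
Fact padic_ent_split A : padic_ent A ->
  exists2 B, padic_ent B & (B \; B)%relation `<=` A.
Proof.
move=> [n _ nA].
exists [set xy : Qp * Qp | padic_lattice n (xy.2 - xy.1)]; first by exists n.
move=> [x y] [z /= xz zy]; apply: nA => /=.
by rewrite -(subrK z y) -addrA; apply: padic_latticeD.
Qed.

HB.instance Definition _ := isUniform.Build Qp
  padic_ent_filter padic_ent_refl padic_ent_inv padic_ent_split.

Lemma padic_nbhsP x (A : set Qp) : nbhs x A <->
  exists n, forall y, padic_lattice n (y - x) -> A y.
Proof.
rewrite -nbhs_entourageE; split.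
  move=> [B [n _ nB] BA]; exists n => y h; apply: BA.
  by apply/xsectionP; apply: nB.
move=> [n nA]; exists [set xy : Qp * Qp | padic_lattice n (xy.2 - xy.1)].
  by exists n.
by move=> y /xsectionP; apply: nA.
Qed.

Lemma padic_scale_lattice c n :
  exists m, forall x, padic_lattice m x -> padic_lattice n (c * x).
Proof.
have [a [b [b0 ->]]] : exists a b : Zp, b != 0 /\
    c = padic_of_int a / padic_of_int b.
  have [a [b [b0 cb]]] := fractionE c; exists a, b; split=> //.
  by rewrite /padic_of_int -cb mulfK// tofrac_eq0.
have [k [e be]] := padic_dvd_pX b0.
exists (k + n)%N => _ [z _ <-]; exists (a * e * z) => //.
have b0' : padic_of_int b != 0 by rewrite /padic_of_int tofrac_eq0.
have -> : p%:R ^+ (k + n) = padic_of_int b * padic_of_int e * p%:R ^+ n :> Qp.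
  by rewrite -rmorphM be rmorphXn rmorph_nat exprD.
have aux (F : fieldType) (a' b' e' q' z' : F) : b' != 0 ->
    q' * (a' * e' * z') = a' / b' * (b' * e' * q' * z') by move=> ?; field.
by rewrite !rmorphM; apply: aux.
Qed.

End PadicTopology.

Definition field_units (F : fieldType) : Type := {x : F | x != 0}.

Section FieldUnits.
Variable F : fieldType.
Local Notation U := (field_units F).
Implicit Types x y z : U.

HB.instance Definition _ := SubChoice.copy U {x : F | x != 0}.

Definition funit_one : U := exist _ 1 (oner_neq0 F).
Definition funit_mul x y : U := exist _ (\val x * \val y) (mulf_neq0 (valP x) (valP y)).
Fact funit_inv_subproof x : (\val x)^-1 != 0.
Proof. by rewrite invr_eq0 (valP x). Qed.
Definition funit_inv x : U := exist _ (\val x)^-1 (funit_inv_subproof x).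

Fact funit_mulA : associative funit_mul.
Proof. by move=> x y z; apply: val_inj; rewrite /= mulrA. Qed.
Fact funit_mul1 : left_id funit_one funit_mul.
Proof. by move=> x; apply: val_inj; rewrite /= mul1r. Qed.
Fact funit_mulr1 : right_id funit_one funit_mul.
Proof. by move=> x; apply: val_inj; rewrite /= mulr1. Qed.
Fact funit_mulV : left_inverse funit_one funit_inv funit_mul.
Proof. by move=> x; apply: val_inj; rewrite /= mulVf// (valP x). Qed.
Fact funit_mulrV : right_inverse funit_one funit_inv funit_mul.
Proof. by move=> x; apply: val_inj; rewrite /= mulfV// (valP x). Qed.

HB.instance Definition _ := isGroup.Build U
  funit_mulA funit_mul1 funit_mulr1 funit_mulV funit_mulrV.
End FieldUnits.

Definition upper_triangular (F : fieldType) : pred 'M[F]_2 :=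
  fun g => (g \in unitmx) && (g 1 0 == 0).

Definition borel (F : fieldType) : Type := {g : 'M[F]_2 | upper_triangular g}.

Section Borel.
Variable F : fieldType.
Local Notation B := (borel F).
Implicit Types g h k : B.

HB.instance Definition _ := SubChoice.copy B {g : 'M[F]_2 | upper_triangular g}.

Lemma borel_unitmx g : \val g \in unitmx.
Proof. by have /andP[] := valP g. Qed.
Lemma borel10 g : \val g 1 0 = 0.
Proof. by have /andP[_ /eqP] := valP g. Qed.

Lemma mulmx2E (A C : 'M[F]_2) i j : (A *m C) i j = A i 0 * C 0 j + A i 1 * C 1 j.
Proof. by rewrite mxE !big_ord_recl big_ord0 addr0; congr (_ + A _ _ * C _ _); apply: val_inj. Qed.

Lemma borel_diag_neq0 g : (\val g 0 0 != 0) * (\val g 1 1 != 0).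
Proof.
have h := mulVmx (borel_unitmx g); have h' := mulmxV (borel_unitmx g).
have := congr1 (fun M : 'M[F]_2 => M 1 1) h'; have := congr1 (fun M : 'M[F]_2 => M 0 0) h.
rewrite !mulmx2E !borel10 mulr0 mul0r addr0 add0r !mxE /= => e0 e1.
split; apply/eqP => z; first by move: e0; rewrite z mulr0 => /esym/eqP; rewrite oner_eq0.
by move: e1; rewrite z mul0r => /esym/eqP; rewrite oner_eq0.
Qed.

Fact borel_one_subproof : @upper_triangular F 1%:M.
Proof. by rewrite /upper_triangular unitmx1 mxE eqxx. Qed.
Definition borel_one : B := exist _ 1%:M borel_one_subproof.

Fact borel_mul_subproof g h : upper_triangular (\val g *m \val h).
Proof.
rewrite /upper_triangular unitmx_mul !borel_unitmx/=.
by rewrite mulmx2E !borel10 mulr0 mul0r addr0.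
Qed.
Definition borel_mul g h : B := exist _ (\val g *m \val h) (borel_mul_subproof g h).

Fact borel_inv_subproof g : upper_triangular (invmx (\val g)).
Proof.
rewrite /upper_triangular unitmx_inv borel_unitmx/=.
have := congr1 (fun M : 'M[F]_2 => M 1 0) (mulmxV (borel_unitmx g)).
rewrite mulmx2E borel10 mul0r add0r mxE /= => /eqP.
by rewrite mulf_eq0 (negPf (borel_diag_neq0 g).2).
Qed.
Definition borel_inv g : B := exist _ (invmx (\val g)) (borel_inv_subproof g).

Fact borel_mulA : associative borel_mul.
Proof. by move=> x y z; apply: val_inj; rewrite /= mulmxA. Qed.
Fact borel_mul1 : left_id borel_one borel_mul.
Proof. by move=> x; apply: val_inj; rewrite /= mul1mx. Qed.
Fact borel_mulr1 : right_id borel_one borel_mul.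
Proof. by move=> x; apply: val_inj; rewrite /= mulmx1. Qed.
Fact borel_mulV : left_inverse borel_one borel_inv borel_mul.
Proof. by move=> x; apply: val_inj; rewrite /= mulVmx ?borel_unitmx. Qed.
Fact borel_mulrV : right_inverse borel_one borel_inv borel_mul.
Proof. by move=> x; apply: val_inj; rewrite /= mulmxV ?borel_unitmx. Qed.

HB.instance Definition _ := isGroup.Build B
  borel_mulA borel_mul1 borel_mulr1 borel_mulV borel_mulrV.

(* The matrix g is ((a, b), (0, d)). *)
Definition borel_a g : field_units F := exist _ (\val g 0 0) (borel_diag_neq0 g).1.
Definition borel_d g : field_units F := exist _ (\val g 1 1) (borel_diag_neq0 g).2.
Definition borel_b g : F := \val g 0 1.

Fact borel_scalar_subproof (x : field_units F) : upper_triangular (\val x)%:M.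
Proof.
apply/andP; split; last by rewrite mxE.
by rewrite unitmxE det_scalar unitfE expf_neq0// (valP x).
Qed.
Definition borel_scalar (x : field_units F) : B :=
  exist _ (\val x)%:M (borel_scalar_subproof x).

End Borel.

(* Both groups carry the topology induced from the ambient space: for Q_p^x   *)
(* and B this is a group topology, as inversion is continuous on units.       *)
HB.instance Definition _ p (p_pr : prime p) :=
  Topological.copy (field_units (padic p_pr))
    (initial_topology (val : field_units (padic p_pr) -> padic p_pr)).
HB.instance Definition _ p (p_pr : prime p) :=
  Topological.copy (borel (padic p_pr))
    (initial_topology (val : borel (padic p_pr) -> 'M[padic p_pr]_2)).

Section BorelPadic.
Variables (p : nat) (p_pr : prime p).
Local Notation Qp := (padic p_pr).
Local Notation B := (borel Qp).

Definition padic_integers : set Qp := range (@padic_of_int p p_pr).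
Definition padic_integer_units : set Qp :=
  [set padic_of_int z | z in [set z : padic_int p_pr | z \is a GRing.unit]].

Definition borel_K : set B :=
  [set g | [/\ padic_integer_units (\val (borel_a g)),
               padic_integer_units (\val (borel_d g)) &
               padic_integers (borel_b g)]].

Definition borel_Z : set B := range (@borel_scalar Qp).

Definition borel_KZ : set B := [set (k * z)%g | k in borel_K & z in borel_Z].

Lemma borel_mulr_continuous (h : B) : continuous (fun g : B => (g * h)%g).
Proof.
suff H : continuous (fun A : 'M[Qp]_2 => A *m \val h).
  move=> g U [_ [[W oW <-] /= Wgh] WU].
  have : nbhs (\val g) (fun A => W (A *m \val h)).
    by apply: H; rewrite /= -[_ *m _]/(\val (g * h)%g); exact: open_nbhs_nbhs.
  move=> WN; have : nbhs g (fun g' : B => W (\val (g' * h)%g)).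
    exact: (@initial_continuous _ _ (val : B -> 'M[Qp]_2) g _ WN).
  by apply: filterS => g' Wg'; exact: WU.
move=> A U [P AP PU].
have /choice[m mP] : forall ij : 'I_2 * 'I_2, exists m, forall x y : Qp,
    padic_lattice m x -> padic_lattice m y ->
    P ij.1 ij.2 ((A *m \val h) ij.1 ij.2 + x * \val h 0 ij.2 + y * \val h 1 ij.2).
  move=> [i j]; have /padic_nbhsP[n nP] := AP i j.
  have [m0 H0] := padic_scale_lattice (\val h 0 j) n.
  have [m1 H1] := padic_scale_lattice (\val h 1 j) n.
  exists (maxn m0 m1) => x y mx my; apply: nP.
  rewrite /= -(addrA _ (x * _)) addrC addrK ![_ * \val h _ _]mulrC; apply: padic_latticeD.
    by apply: H0; apply: padic_lattice_le mx; rewrite leq_maxl.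
  by apply: H1; apply: padic_lattice_le my; rewrite leq_maxr.
pose M := \max_ij m ij.
exists (fun i j => [set y | padic_lattice M (y - A i j)]).
  by move=> i j; apply/padic_nbhsP; exists M.
move=> A' A'P; apply: PU => i j.
rewrite (_ : _ i j = (A *m \val h) i j + (A' i 0 - A i 0) * \val h 0 j
    + (A' i 1 - A i 1) * \val h 1 j); last first.
  by rewrite !mulmx2E; ring.
by apply: (mP (i, j)); apply: padic_lattice_le (A'P _ _); exact: leq_bigmax.
Qed.

End BorelPadic.

Section Representation.
Variables (G : groupType) (F : fieldType).

Record representation (V : lmodType F) := Representation {
  repr_act :> G -> V -> V;
  repr_linear : forall g, linear (repr_act g);
  repr_act1 : forall v, repr_act 1%g v = v;
  repr_actM : forall g h v, repr_act (g * h)%g v = repr_act g (repr_act h v) }.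

Definition irreducible_repr (V : lmodType F) (rho : representation V) : Prop :=
  (exists v : V, v != 0) /\
  forall W : set V, W 0 ->
    (forall a v w, W v -> W w -> W (a *: v + w)) ->
    (forall g v, W v -> W (rho g v)) ->
    W = [set 0] \/ W = setT.

(* rho is a quotient of tau. *)
Definition quotient_repr (V W : lmodType F)
    (rho : representation V) (tau : representation W) : Prop :=
  exists f : {linear W -> V},
    (forall g w, f (tau g w) = rho g (f w)) /\ (forall v, exists w, f w = v).

End Representation.

Section BorelRepr.
Variables (p : nat) (p_pr : prime p) (E : fieldType).
Local Notation Qp := (padic p_pr).
Local Notation B := (borel Qp).
Implicit Types s : {multiplicative field_units Qp -> field_units E}%g.

(* A character is smooth when its kernel is open, i.e. when it is smooth as a *)
(* one-dimensional representation.                                            *)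
Definition smooth_character s : Prop := open [set x | s x = 1%g].

Definition smooth_repr (V : lmodType E) (rho : representation B V) : Prop :=
  forall v, open [set g | rho g v = v].

Definition admits_central_character (V : lmodType E) (rho : representation B V) : Prop :=
  exists w : {multiplicative field_units Qp -> field_units E}%g,
    forall x v, rho (borel_scalar x) v = \val (w x) *: v.

(* The formula makes sense on all of B; it is only used on KZ. *)
Definition tensor_character s1 s2 (g : B) : E :=
  \val (s1 (borel_a g)) * \val (s2 (borel_d g)).

(* S is compact modulo Z when it is covered by the Z-translates of a compact  *)
(* subset of B.                                                               *)
Definition compact_mod_center (S : set B) : Prop :=
  exists2 C : set B, compact C &
    S `<=` [set (c * z)%g | c in C & z in @borel_Z p p_pr].

(* The codomain is E^o, the regular module, so that B -> E^o is an E-module   *)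
(* even when E itself carries the module structure of a smaller base field.   *)
Definition ind_pred s1 s2 : set (B -> E^o) :=
  [set f | (forall k g, borel_KZ k -> f (k * g)%g = tensor_character s1 s2 k * f g)
           /\ compact_mod_center [set g | f g != 0]].

Lemma compact_mod_center0 : compact_mod_center set0.
Proof. by exists set0; [exact: compact0|]. Qed.

Lemma compact_mod_centerU (S T : set B) :
  compact_mod_center S -> compact_mod_center T -> compact_mod_center (S `|` T).
Proof.
move=> [C cC SC] [D cD TD]; exists (C `|` D); first exact: compactU.
move=> g [/SC|/TD] [c Cc [z Zz <-]]; exists c; try exists z => //; [by left|by right].
Qed.

Lemma compact_mod_centerS (S T : set B) :
  S `<=` T -> compact_mod_center T -> compact_mod_center S.
Proof. by move=> ST [C cC TC]; exists C => //; exact: subset_trans TC. Qed.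

Lemma borel_scalar_commute x (g : B) : commute g (borel_scalar x).
Proof. by apply: val_inj; rewrite /= scalar_mxC. Qed.

Lemma compact_mod_center_mulr (S : set B) h : compact_mod_center S ->
  compact_mod_center [set g | S (g * h)%g].
Proof.
move=> [C cC SC]; exists [set (c * h^-1)%g | c in C].
  by apply: continuous_compact => //; apply/continuous_subspaceT/borel_mulr_continuous.
move=> g /SC [c Cc [_ [x _ <-] gE]]; exists (c * h^-1)%g; first by exists c.
exists (borel_scalar x); first by exists x.
by rewrite -mulgA borel_scalar_commute mulgA gE mulgK.
Qed.

Fact ind_closed s1 s2 : submod_closed [in ind_pred s1 s2].
Proof.
split.
  rewrite inE; split=> [k g _|]; first by rewrite mulr0.
  by apply: compact_mod_centerS compact_mod_center0 => g /=; rewrite eqxx.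
move=> a f f'; rewrite !inE => -[fK fc] [f'K f'c]; split=> [k g kK|].
  rewrite !fctE fK// f'K// mulrDr; congr (_ + _).
  by rewrite /GRing.scale /= mulrCA.
apply: compact_mod_centerS (compact_mod_centerU fc f'c) => g /=.
apply: contraPP => /not_orP[/negP + /negP]; rewrite !negbK => /eqP f0 /eqP f'0.
by apply/negP; rewrite negbK !fctE f0 f'0 scaler0 addr0.
Qed.

Definition ind s1 s2 : Type := {f : B -> E^o | f \in ind_pred s1 s2}.

HB.instance Definition _ s1 s2 :=
  SubChoice.copy (ind s1 s2) {f : B -> E^o | f \in ind_pred s1 s2}.
HB.instance Definition _ s1 s2 :=
  GRing.SubChoice_isSubLmodule.Build E (B -> E^o) _ (ind s1 s2) (ind_closed s1 s2).

Fact ind_act_subproof s1 s2 (g : B) (f : ind s1 s2) :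
  (fun h => \val f (h * g)%g) \in ind_pred s1 s2.
Proof.
have := valP f; rewrite !inE => -[fK fc]; split=> [k h kK|].
  by rewrite /= -mulgA fK.
exact: (compact_mod_center_mulr g fc).
Qed.
Definition ind_act s1 s2 (g : B) (f : ind s1 s2) : ind s1 s2 :=
  exist _ (fun h => \val f (h * g)%g) (ind_act_subproof g f).

Fact ind_act_linear s1 s2 (g : B) : linear (@ind_act s1 s2 g).
Proof. by move=> a f f'; apply: val_inj; apply/funext => h. Qed.
Fact ind_act1 s1 s2 (f : ind s1 s2) : ind_act 1%g f = f.
Proof. by apply: val_inj; apply/funext => h /=; rewrite mulg1. Qed.
Fact ind_actM s1 s2 (g h : B) (f : ind s1 s2) :
  ind_act (g * h)%g f = ind_act g (ind_act h f).
Proof. by apply: val_inj; apply/funext => x /=; rewrite mulgA. Qed.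

Definition ind_repr s1 s2 : representation B (ind s1 s2) :=
  Representation (@ind_act_linear s1 s2) (@ind_act1 s1 s2) (@ind_actM s1 s2).

End BorelRepr.

(* Main.v *)
Require Import Defs.
From HB Require Import structures.
From mathcomp Require Import all_boot all_order all_algebra all_field.
From mathcomp Require Import cyclic finmap.
From mathcomp Require Import all_classical all_reals all_analysis.
From mathcomp Require Import ring.

(* By Frobenius reciprocity it suffices to find a nonzero vector v on which   *)
(* KZ acts by a character of the form sigma1 (x) sigma2: the map sending f to *)
(* the sum of f(x) x^-1 v over KZ\B is then onto, as Pi is irreducible. To    *)
(* find v, start from any nonzero v0. A power p^n of the unipotent element u  *)
(* with entry 1 fixes v0, so u has an eigenvector, of eigenvalue 1 since the  *)
(* characteristic is p, among the vectors fixed by an open subgroup of the    *)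
(* unipotent group; by smoothness it is fixed by all unipotents with entry in *)
(* Z_p. The torus of the diag(a, 1), with a a p-adic unit, preserves the      *)
(* space of such vectors and acts on a given one through (Z/p^n)^x; as        *)
(* X^(p^n) - X^(p^(n-1)) = (X^p - X)^(p^(n-1)) splits over F_p, commuting     *)
(* operators annihilated by it have a common eigenvector. The resulting       *)
(* character of Z_p^x is extended to Q_p^x by sending p to 1.                 *)

Set Implicit Arguments.
Unset Strict Implicit.
Unset Printing Implicit Defensive.

Import GRing.Theory.
Local Open Scope classical_set_scope.
Local Open Scope ring_scope.

(** * p-adic integers *)

(** [frobenius_eigenvector] is used twice: [unip_fixed_neq0] applies it to one unipotent, and
    [torus_eigenvector] to one torus element per class of units modulo p^n. V may be infinite
    dimensional: smoothness supplies the relation f^(p^(m+1)) v = f^(p^m) v that it needs. Every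
    triangular matrix is a scalar times a unipotent times some diag(a, 1) ([borel_mx_decomp]), so
    [KZ_eigenvector] can take for sigma1 the torus character, extended through [unit_part], and for
    sigma2 the central character divided by sigma1.

    On the induced side, K is open and compact ([nbhs1_borel_K], [borel_K_compact]), so an element
    of the induced representation lives on finitely many cosets of KZ and the sum [frob] makes
    sense. It is equivariant and sends [ind_base] to v, whence [KZ_eigenvector_quotient]. *)

Section PadicIntegers.
Variables (p : nat) (p_pr : prime p).
Local Notation Zp := (padic_int p_pr).
Local Notation Qp := (padic p_pr).
Implicit Types x y z u : Zp.

Lemma pX_gt0 n : (0 < p ^ n)%N. Proof. by rewrite expn_gt0 prime_gt0. Qed.

Lemma padic_res0n n : (0 : Zp) n = 0%N. Proof. by rewrite /= mod0n. Qed.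

Lemma padic_resX x m n : (x ^+ m : Zp) n = ((x n ^ m) %% p ^ n)%N.
Proof.
elim: m => [|m IH]; first by rewrite expr0.
by rewrite exprS padic_resM IH modnMmr expnS.
Qed.

(** Dividing by p^n costs n digits of precision, so the m-th residue of the quotient is read off the
    residue of index m + n. *)
Lemma padic_res_eq0P x n : x n = 0%N -> exists z, x = p%:R ^+ n * z.
Proof.
move=> x0; pose f m := (x (m + n)%N %/ p ^ n)%N.
have fE m : (f m * p ^ n = x (m + n))%N.
  by rewrite divnK// /dvdn padic_res_modn ?leq_addl// x0.
have fP m : f m.+1 = f m %[mod p ^ m].
  apply/eqP; rewrite -(eqn_pmul2r (pX_gt0 n)) !muln_modl -expnD !fE.
  by rewrite addSn padic_resP padic_res_small.
exists (padic_mk p_pr fP); apply: padic_ext => m.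
rewrite -natrX padic_resM padic_res_nat /= modnMm mulnC fE.
by rewrite padic_res_modn// leq_addr.
Qed.

Lemma padic_res_pXM x n : (p%:R ^+ n * x : Zp) n = 0%N.
Proof. by rewrite -natrX padic_resM padic_res_nat modnn mul0n mod0n. Qed.

Lemma padic_res_eqP x y n : x n = y n -> exists z, x - y = p%:R ^+ n * z.
Proof.
move=> xy; apply: padic_res_eq0P.
by rewrite padic_resD xy /= modnDmr subnKC ?modnn// ltnW// (padic_res_lt y).
Qed.

Lemma padic_eq_res x y n z : x - y = p%:R ^+ n * z -> x n = y n.
Proof.
move=> /(canRL (subrK y)) ->; rewrite padic_resD padic_res_pXM add0n.
exact: padic_res_small.
Qed.

Lemma padic_p_neq0 : (p%:R : Zp) != 0.
Proof.
apply/eqP => /(congr1 (fun x : Zp => x 2)); rewrite padic_res_nat padic_res0n.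
rewrite modn_small; last by rewrite ltn_Pmulr ?prime_gt1 ?prime_gt0.
by move=> p0; have := prime_gt0 p_pr; rewrite p0.
Qed.

(** For the converse, write x e = p^k. As p does not divide x, it divides e when k > 0; cancelling p
    lowers k until x e = 1. *)
Lemma padic_int_unitE x : (x \is a GRing.unit) = (x 1%N != 0%N).
Proof.
apply/idP/idP => [xu|x1].
  apply/eqP => x0; have := congr1 (fun x : Zp => x 1%N) (mulrV xu).
  rewrite padic_resM x0 mul0n mod0n -[1]/(1%:R) padic_res_nat expn1 modn_small ?prime_gt1//.
have /padic_dvd_pX[k [e]] : x != 0.
  by apply: contraNneq x1 => ->; rewrite padic_res0n.
elim: k e => [|k IH] e xe.
  by rewrite unitrE; apply/eqP; apply: mulrV; apply/asboolP; exists e; rewrite mulrC.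
have /padic_res_eq0P[z ez] : e 1%N = 0%N.
  have : (x * e : Zp) 1%N = 0%N by rewrite xe exprS -[p%:R]expr1 padic_res_pXM.
  rewrite padic_resM => /eqP; rewrite -/(dvdn _ _) expn1 Euclid_dvdM//.
  rewrite /dvdn -[X in (x 1 %% X)%N]expn1 -[X in (e 1 %% X)%N]expn1 !padic_res_small.
  by rewrite (negPf x1) => /eqP.
apply: (IH z); apply: (mulfI padic_p_neq0).
by rewrite mulrCA -exprS -xe ez expr1.
Qed.

Lemma padic_int_decomp x : x != 0 ->
  exists n u, u \is a GRing.unit /\ x = p%:R ^+ n * u.
Proof.
move=> x0; have : exists n, x n != 0%N.
  apply: contrapT => xn; move/eqP: x0; apply; apply: padic_ext => n.
  by rewrite padic_res0n; apply/eqP; apply/negP => /negP h; apply: xn; exists n.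
move=> /ex_minnP[[|n] xn nmin].
  (* The residue of index 0 is modulo 1, hence zero, so the least index with a nonzero residue is a
     successor. *)
  by move: xn (padic_res_lt x 0); case: (x 0%N).
have [|z xz] := @padic_res_eq0P x n.
  by apply/eqP; apply/negP => /negP/nmin; rewrite ltnn.
exists n, z; split=> //; rewrite padic_int_unitE; apply: contra_neqN xn => z1.
have [w zw] : exists w, z = p%:R ^+ 1 * w by apply: padic_res_eq0P; apply/eqP.
by rewrite xz zw mulrA -exprD addn1 padic_res_pXM.
Qed.

Lemma padic_unit_res_coprime u n : u \is a GRing.unit -> coprime (u n) (p ^ n).
Proof.
rewrite padic_int_unitE => u1; case: n => [|n]; first by rewrite expn0 coprimen1.
rewrite coprimeXr// coprime_sym prime_coprime//; apply: contra u1.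
by rewrite -(@padic_res_modn _ p_pr u 1 n.+1)// expn1.
Qed.

(** After cancelling the smaller power of p, a unit would be divisible by p unless the exponents
    agree. This makes [unit_part] well defined. *)
Lemma padic_unit_decomp_inj u u' m n :
  u \is a GRing.unit -> u' \is a GRing.unit ->
  p%:R ^+ m * u = p%:R ^+ n * u' -> u = u'.
Proof.
wlog mn : u u' m n / (m <= n)%N => [H|uu uu'].
  move=> uu uu' e; have [/H|/ltnW/H] := leqP m n; first exact.
  by move=> h; apply/esym/h.
rewrite -(subnKC mn) exprD -mulrA => /(mulfI (expf_neq0 m padic_p_neq0)).
case: (n - m)%N => [|k] e; first by rewrite expr0 mul1r in e.
have : (p%:R ^+ k.+1 * u') 1%N = 0%N by rewrite exprS -mulrA -[p%:R]expr1 padic_res_pXM.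
by rewrite -e => u0; move: uu; rewrite padic_int_unitE u0.
Qed.

Lemma padic_of_int_inj : injective (@padic_of_int p p_pr).
Proof.
by move=> x y e; apply/eqP; rewrite -subr_eq0 -tofrac_eq0 rmorphB/= [X in X - _]e subrr.
Qed.

Lemma padic_of_int_eq0 x : (padic_of_int x == 0) = (x == 0).
Proof. exact: tofrac_eq0. Qed.

(** The valuation n - m is recorded by two natural exponents, those of the denominator and of the
    numerator, which avoids negative powers of p. *)
Lemma padic_decomp (x : Qp) : x != 0 -> exists m n u,
  u \is a GRing.unit /\ x * p%:R ^+ m = p%:R ^+ n * padic_of_int u.
Proof.
move=> x0; have [a [b [b0 xb]]] : exists a b : Zp, b != 0 /\ x * padic_of_int b = padic_of_int a.
  exact: fractionE.
have a0 : a != 0 by rewrite -padic_of_int_eq0 -xb mulf_neq0// padic_of_int_eq0.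
have [n [u [uu au]]] := padic_int_decomp a0.
have [m [v [vu bv]]] := padic_int_decomp b0.
exists m, n, (u / v); split; first by rewrite unitrM uu unitrV.
have v0 : padic_of_int v != 0.
  by rewrite padic_of_int_eq0; apply: contraTneq vu => ->; rewrite unitr0.
apply: (mulIf v0); rewrite -!mulrA -rmorphM/= mulrVK//.
by move: xb; rewrite au bv !rmorphM !rmorphXn !rmorph_nat.
Qed.

End PadicIntegers.

(** * Eigenvectors of operators annihilated by a split polynomial *)

Definition is_subspace (E : pzRingType) (V : lmodType E) (U : set V) : Prop :=
  U 0 /\ forall (a : E) v w, U v -> U w -> U (a *: v + w).

Section Eigenvectors.
Variables (E : fieldType) (V : lmodType E).
Implicit Types (f : {linear V -> V}) (q : {poly E}) (v w : V) (U : set V).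

(** The vector q(f) v, written with iterates because V need not be finite dimensional. *)
Definition poly_act f q v : V := \sum_(i < size q) q`_i *: iter i f v.

Lemma poly_act_wide f q v n : (size q <= n)%N ->
  poly_act f q v = \sum_(i < n) q`_i *: iter i f v.
Proof.
move=> qn; rewrite /poly_act (big_ord_widen _ (fun i => q`_i *: iter i f v) qn).
rewrite big_mkcond; apply: eq_bigr => i _; case: ltnP => // qi.
by rewrite nth_default// scale0r.
Qed.

Lemma poly_actB f q r v : poly_act f (q - r) v = poly_act f q v - poly_act f r v.
Proof.
pose n := maxn (size q) (size r).
have le1 : (size (q - r)%R <= n)%N by rewrite (leq_trans (size_polyD _ _))// size_polyN.
rewrite (poly_act_wide f v le1) (@poly_act_wide f q v n) ?leq_maxl//.
rewrite (@poly_act_wide f r v n) ?leq_maxr// -sumrB.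
by apply: eq_bigr => i _; rewrite coefB scalerBl.
Qed.

Lemma poly_actZ f a q v : poly_act f (a *: q) v = a *: poly_act f q v.
Proof.
rewrite (@poly_act_wide f (a *: q) v (size q)) ?size_scale_leq// scaler_sumr.
by apply: eq_bigr => i _; rewrite coefZ scalerA.
Qed.

Lemma poly_act_lin f q a v w :
  poly_act f q (a *: v + w) = a *: poly_act f q v + poly_act f q w.
Proof.
rewrite /poly_act scaler_sumr -big_split; apply: eq_bigr => i _ /=.
rewrite scalerA mulrC -scalerA -scalerDr; congr (_ *: _).
by elim: (i : nat) => //= k ->; rewrite linearP.
Qed.

Lemma poly_actMX f q v : poly_act f ('X * q) v = poly_act f q (f v).
Proof.
have le1 : (size ('X * q)%R <= (size q).+1)%N.
  by rewrite (leq_trans (size_polyMleq _ _))// size_polyX.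
rewrite (poly_act_wide f v le1) big_ord_recl coefXM scale0r add0r.
by apply: eq_bigr => i _; rewrite coefXM /= -iterSr.
Qed.

Lemma poly_actMXsubC f c q v :
  poly_act f (('X - c%:P) * q) v = poly_act f q (f v - c *: v).
Proof.
rewrite mulrBl poly_actB poly_actMX mul_polyC poly_actZ addrC -scaleNr.
by rewrite -poly_act_lin scaleNr addrC.
Qed.

Lemma poly_actXn f n v : poly_act f 'X^n v = iter n f v.
Proof.
rewrite (@poly_act_wide f _ v n.+1) ?size_polyXn// big_ord_recr coefXn eqxx scale1r.
rewrite big1 => [|i _]; first exact: add0r.
by rewrite coefXn (ltn_eqF (ltn_ord i)) scale0r.
Qed.

(** Apply the factors f - c one after the other: the last nonzero vector before the result vanishes
    is an eigenvector, and every vector on the way stays in U. *)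
Lemma split_poly_eigenvector f U (cs : seq E) v :
  is_subspace U -> (forall w, U w -> U (f w)) -> U v -> v != 0 ->
  poly_act f (\prod_(c <- cs) ('X - c%:P)) v = 0 ->
  exists c w, [/\ U w, w != 0 & f w = c *: w].
Proof.
move=> [U0 Ulin] Uf; elim: cs v => [|c cs IH] v Uv v0.
  by rewrite big_nil -(expr0 'X) poly_actXn /= => /eqP; rewrite (negPf v0).
rewrite big_cons poly_actMXsubC; have [/eqP|w0] := eqVneq (f v - c *: v) 0.
  by rewrite subr_eq0 => /eqP fv _; exists c, v.
apply: IH => //; rewrite addrC -scaleNr; exact/Ulin/Uf.
Qed.

End Eigenvectors.

(* Over F_p the polynomial X^(p^(m+1)) - X^(p^m) = (X^p - X)^(p^m) splits. *)
Lemma frobenius_eigenvector (p : nat) (p_pr : prime p) (E : fieldExtType 'F_p)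
    (V : lmodType E) (f : {linear V -> V}) (U : set V) v m :
  is_subspace U -> (forall w, U w -> U (f w)) -> U v -> v != 0 ->
  iter (p ^ m.+1) f v = iter (p ^ m) f v ->
  exists c w, [/\ U w, w != 0 & f w = c *: w].
Proof.
move=> Usub Uf Uv v0 fv.
have genp : \prod_(x : 'F_p) ('X - (x%:A : E)%:P) = 'X^p - 'X.
  have := congr1 (map_poly (in_alg E)) (finField_genPoly 'F_p).
  rewrite card_Fp// rmorphB/= map_polyXn map_polyX => ->.
  by rewrite rmorph_prod/=; apply: eq_bigr => x _; rewrite rmorphB/= map_polyX map_polyC.
have pE : p \in [pchar {poly E}].
  by rewrite pchar_poly pchar_lalg pchar_Fp.
(* The roots of (X^p - X)^(p^m), each element of F_p with multiplicity p^m. *)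
pose cs := flatten (nseq (p ^ m) [seq (x%:A : E) | x <- enum 'F_p]).
apply: (@split_poly_eigenvector _ _ f U cs v) => //.
have -> : \prod_(c <- cs) ('X - c%:P) = 'X^(p ^ m.+1) - 'X^(p ^ m) :> {poly E}.
  transitivity (('X^p - 'X : {poly E}) ^+ (p ^ m)).
    rewrite /cs -genp; elim: (p ^ m)%N => [|k IH] /=; first by rewrite big_nil expr0.
    by rewrite big_cat IH exprS big_map big_enum.
  have pnE : [pchar {poly E}].-nat (p ^ m)%N by rewrite (eq_pnat _ (pcharf_eq pE)) pnatX pnat_id.
  rewrite exprDn_pchar// exprNn_pchar//.
  by rewrite -exprM expnS.
by rewrite poly_actB !poly_actXn fv subrr.
Qed.

(** * Triangular matrices and their topology *)

Section BorelMatrix.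
Variable F : fieldType.
Local Notation B := (borel F).
Local Notation U := (field_units F).

Lemma ord2P (P : 'I_2 -> Prop) : P 0 -> P 1 -> forall i, P i.
Proof.
by move=> P0 P1 [[|[|//]] i2]; [move: P0|move: P1]; congr P; apply: val_inj.
Qed.

Definition triangular_mx (a b d : F) : 'M[F]_2 :=
  \matrix_(i, j) if i == 0 then if j == 0 then a else b else if j == 0 then 0 else d.

Fact borel_mx_subproof (a d : U) b : upper_triangular (triangular_mx (val a) b (val d)).
Proof.
apply/andP; split; last by rewrite mxE.
rewrite unitmxE (expand_det_col _ 0) !big_ord_recl big_ord0 !mxE /= mul0r !addr0.
rewrite unitfE mulf_neq0 ?(valP a)//.
by rewrite /cofactor det_mx11 !mxE /= mulf_neq0 ?expf_neq0 ?oppr_eq0 ?oner_neq0 ?(valP d).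
Qed.
Definition borel_mx (a : U) (b : F) (d : U) : B :=
  exist (@upper_triangular F) _ (borel_mx_subproof a d b).

Lemma borel_mxE (g : B) : g = borel_mx (borel_a g) (borel_b g) (borel_d g).
Proof.
apply: val_inj; apply/matrixP => i j; rewrite mxE.
elim/ord2P: i; elim/ord2P: j => //=; exact: borel10.
Qed.

Lemma borel_mx_eq (a a' d d' : U) b b' :
  a = a' -> b = b' -> d = d' -> borel_mx a b d = borel_mx a' b' d'.
Proof. by move=> -> -> ->. Qed.

Lemma borel_mxM (a a' d d' : U) b b' :
  (borel_mx a b d * borel_mx a' b' d')%g =
  borel_mx (a * a')%g (val a * b' + b * val d') (d * d')%g.
Proof.
apply: val_inj; apply/matrixP => i j; rewrite /= mulmx2E !mxE.
by elim/ord2P: i; elim/ord2P: j => //=; rewrite ?mul0r ?mulr0 ?addr0 ?add0r.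
Qed.

Lemma borel_scalarE x : borel_scalar x = borel_mx x 0 x.
Proof.
apply: val_inj; apply/matrixP => i j; rewrite !mxE.
by elim/ord2P: i; elim/ord2P: j.
Qed.

Lemma borel_oneE : 1%g = borel_mx 1%g 0 1%g.
Proof.
apply: val_inj; apply/matrixP => i j; rewrite !mxE.
by elim/ord2P: i; elim/ord2P: j.
Qed.

Lemma borel_a_mx (a d : U) b : borel_a (borel_mx a b d) = a.
Proof. by apply: val_inj; rewrite /= mxE. Qed.
Lemma borel_d_mx (a d : U) b : borel_d (borel_mx a b d) = d.
Proof. by apply: val_inj; rewrite /= mxE. Qed.
Lemma borel_b_mx (a d : U) b : borel_b (borel_mx a b d) = b.
Proof. by rewrite /borel_b mxE. Qed.

Lemma borel_aM (g h : B) : borel_a (g * h)%g = (borel_a g * borel_a h)%g.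
Proof. by rewrite (borel_mxE g) (borel_mxE h) borel_mxM !borel_a_mx. Qed.
Lemma borel_dM (g h : B) : borel_d (g * h)%g = (borel_d g * borel_d h)%g.
Proof. by rewrite (borel_mxE g) (borel_mxE h) borel_mxM !borel_d_mx. Qed.

End BorelMatrix.

Lemma funit_mulC (F : fieldType) (x y : field_units F) : (x * y)%g = (y * x)%g.
Proof. by apply: val_inj; rewrite /= mulrC. Qed.

Section Topology.
Variables (p : nat) (p_pr : prime p).
Local Notation Zp := (padic_int p_pr).
Local Notation Qp := (padic p_pr).
Local Notation B := (borel Qp).
Local Notation U := (field_units Qp).

Lemma padic_matrix_nbhsP (M : 'M[Qp]_2) (A : set 'M[Qp]_2) : nbhs M A <->
  exists n, forall N : 'M[Qp]_2, (forall i j, padic_lattice n (N i j - M i j)) -> A N.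
Proof.
split=> [[P MP PA]|[n nA]].
  have /choice[m mP] : forall ij : 'I_2 * 'I_2, exists m, forall y : Qp,
      padic_lattice m (y - M ij.1 ij.2) -> P ij.1 ij.2 y.
    by move=> [i j]; have /padic_nbhsP[n nP] := MP i j; exists n.
  exists (\max_ij m ij) => N NM; apply: PA => i j; apply: (mP (i, j)).
  by apply: padic_lattice_le (NM _ _); exact: leq_bigmax.
exists (fun i j => [set y | padic_lattice n (y - M i j)]); last by move=> N /nA.
by move=> i j; apply/padic_nbhsP; exists n.
Qed.

Lemma borel_nbhsP (g : B) (A : set B) : nbhs g A <->
  exists n, forall h : B, (forall i j, padic_lattice n (val h i j - val g i j)) -> A h.
Proof.
split=> [[_ [[W oW <-] /= Wg] WA]|[n nA]].
  have /padic_matrix_nbhsP[n nW] : nbhs (val g) W by exact: open_nbhs_nbhs.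
  by exists n => h /nW; exact: WA.
have : nbhs (val g) [set N | forall i j, padic_lattice n (N i j - val g i j)].
  by apply/padic_matrix_nbhsP; exists n.
move=> /(@initial_continuous _ _ (val : B -> 'M[Qp]_2) g) gA.
by apply: (@filterS _ (nbhs g) _ _ _ _ gA) => h; exact: nA.
Qed.

Lemma funit_nbhsP (x : U) (A : set U) : nbhs x A <->
  exists n, forall y : U, padic_lattice n (val y - val x) -> A y.
Proof.
split=> [[_ [[W oW <-] /= Wg] WA]|[n nA]].
  have /padic_nbhsP[n nW] : nbhs (val x) W by exact: open_nbhs_nbhs.
  by exists n => h /nW; exact: WA.
have : nbhs (val x) [set y | padic_lattice n (y - val x)].
  by apply/padic_nbhsP; exists n.
move=> /(@initial_continuous _ _ (val : U -> Qp) x) gA.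
by apply: (@filterS _ (nbhs x) _ _ _ _ gA) => h; exact: nA.
Qed.

Lemma borel_mx_nbhs (a d : U) b (A : set B) : nbhs (borel_mx a b d) A ->
  exists n, forall a' b' d', padic_lattice n (val a' - val a) ->
    padic_lattice n (b' - b) -> padic_lattice n (val d' - val d) ->
    A (borel_mx a' b' d').
Proof.
move=> /borel_nbhsP[n nA]; exists n => a' b' d' aa bb dd; apply: nA => i j.
rewrite !mxE; elim/ord2P: i; elim/ord2P: j => //=.
by rewrite subrr; exact: padic_lattice0.
Qed.

Lemma padic_latticeP n (x : Qp) : padic_lattice n x <->
  exists z : Zp, x = padic_of_int (p%:R ^+ n * z).
Proof.
split=> [[z _ <-]|[z ->]]; exists z; rewrite ?rmorphM ?rmorphXn ?rmorph_nat//.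
Qed.

End Topology.

(** * Eigenvectors of the maximal compact subgroup *)

(** Makes each operator of a representation a linear map, so that the eigenvector lemmas apply to
    it. *)
HB.instance Definition _ (G : groupType) (F : fieldType) (V : lmodType F)
    (rho : representation G V) (g : G) :=
  GRing.isLinear.Build F V V *:%R (repr_act rho g) (repr_linear rho g).

Section RepresentationTheory.
Variables (G : groupType) (F : fieldType) (V : lmodType F).
Variable rho : representation G V.

Lemma repr_iter g n v : iter n (rho g) v = rho (g ^+ n)%g v.
Proof.
by elim: n => [|n IH]; rewrite ?expg0 ?repr_act1// iterS IH -repr_actM -expgS.
Qed.

Lemma repr_inj g v : rho g v = 0 -> v = 0.
Proof. by move=> gv; rewrite -(repr_act1 rho v) -(mulVg g) repr_actM gv linear0. Qed.

End RepresentationTheory.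

Lemma funit_valX (F : fieldType) (x : field_units F) n : val (x ^+ n)%g = val x ^+ n.
Proof. by elim: n => [|n IH]; rewrite ?expg0// expgS exprS -IH. Qed.

Section Unipotent.
Variable F : fieldType.
Definition unip (z : F) : borel F := borel_mx 1%g z 1%g.
Definition torus (x : field_units F) : borel F := borel_mx x 0 1%g.

Lemma unipM y z : (unip y * unip z)%g = unip (y + z).
Proof. by rewrite /unip borel_mxM mulg1 /= mul1r mulr1 addrC. Qed.

Lemma unipX z n : (unip z ^+ n)%g = unip (z *+ n).
Proof.
elim: n => [|n IH]; first by rewrite expg0 borel_oneE.
by rewrite expgS IH unipM mulrS.
Qed.

Lemma torusM x y : (torus x * torus y)%g = torus (x * y)%g.
Proof. by rewrite /torus borel_mxM mulg1 mulr0 mul0r addr0. Qed.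

Lemma torusX x n : (torus x ^+ n)%g = torus (x ^+ n)%g.
Proof.
elim: n => [|n IH]; first by rewrite expg0 borel_oneE.
by rewrite expgS IH torusM expgS.
Qed.

Lemma unip_torus z x : (unip z * torus x)%g = (torus x * unip ((val x)^-1 * z))%g.
Proof.
rewrite /unip /torus !borel_mxM mulg1 mul1g /= mulr0 add0r mulr1 mul0r addr0.
by rewrite mulg1 mulVKf//; exact: (valP x).
Qed.

End Unipotent.

(** * Vectors fixed by integral unipotents, and torus eigenvectors among them *)

Section FixedVectors.
Variables (p : nat) (p_pr : prime p) (E : fieldExtType 'F_p).
Variables (V : lmodType E) (Pi : representation (borel (padic p_pr)) V).
Local Notation Zp := (padic_int p_pr).
Local Notation Qp := (padic p_pr).
Local Notation U := (field_units Qp).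

Lemma smooth_fixes v : smooth_repr Pi -> exists n, forall a b d,
  padic_lattice n (val a - 1) -> padic_lattice n b -> padic_lattice n (val d - 1) ->
  Pi (borel_mx a b d) v = v.
Proof.
move=> /(_ v) ov; have : nbhs (1%g : borel Qp) [set g | Pi g v = v].
  by apply: open_nbhs_nbhs; split=> //=; exact: repr_act1.
rewrite borel_oneE => /borel_mx_nbhs[n nP]; exists n => a b d an bn dn.
by apply: nP; rewrite ?subr0.
Qed.

(** In characteristic p, c^(p^n) - 1 = (c - 1)^(p^n). *)
Lemma pchar_unity_eq1 (c : E) n : c ^+ (p ^ n) = 1 -> c = 1.
Proof.
move=> c1; have pE : p \in [pchar E] by rewrite pchar_lalg pchar_Fp.
have pnE : [pchar E].-nat (p ^ n)%N.
  by rewrite (eq_pnat _ (pcharf_eq pE)) pnatX pnat_id.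
have : (c - 1) ^+ (p ^ n) = 0.
  by rewrite exprDn_pchar// exprNn_pchar// expr1n c1 subrr.
by move=> /eqP; rewrite expf_eq0 => /andP[_]; rewrite subr_eq0 => /eqP.
Qed.

Definition unip_fixed : set V :=
  [set v | forall z : Zp, Pi (@unip Qp (padic_of_int z)) v = v].

(** The unipotent [unip 1] preserves the space [W] of vectors fixed by the unipotents with entry in
    p^n Z_p, and its p^n-th power is trivial there; so its eigenvalue c satisfies c^(p^n) = 1, hence
    c = 1. *)
Lemma unip_fixed_neq0 (v0 : V) : smooth_repr Pi -> v0 != 0 ->
  exists2 v, unip_fixed v & v != 0.
Proof.
move=> sm v00; have [n nfix] := smooth_fixes v0 sm.
pose W := [set v | forall z : Zp, Pi (unip (padic_of_int (p%:R ^+ n * z))) v = v].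
have Wsub : is_subspace W.
  by split=> [z|a v w vW wW z]; rewrite ?linear0// linearP/= vW wW.
have Wv0 : W v0.
  move=> z; apply: nfix; rewrite ?subrr; try exact: padic_lattice0.
  by apply/padic_latticeP; exists z.
have unipX1 k v : iter k (Pi (unip 1)) v = Pi (unip (padic_of_int k%:R)) v.
  by rewrite repr_iter unipX rmorph_nat.
have Wpn v k : W v -> Pi (unip (padic_of_int (p ^ (n + k))%:R)) v = v.
  by move=> Wv; rewrite natrX exprD Wv.
have Wst w : W w -> W (Pi (unip 1) w).
  by move=> Ww z; rewrite -repr_actM unipM addrC -unipM repr_actM Ww.
(* Both sides equal [v0]; this is the shape of relation that [frobenius_eigenvector] takes. *)
have v0_iter : iter (p ^ n.+1) (Pi (unip 1)) v0 = iter (p ^ n) (Pi (unip 1)) v0.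
  by rewrite !unipX1 -(addn1 n) Wpn// -[in RHS](addn0 n) Wpn.
have [c [w [Ww w0 fw]]] := frobenius_eigenvector p_pr Wsub Wst Wv0 v00 v0_iter.
have iterw k : iter k (Pi (unip 1)) w = c ^+ k *: w.
  by elim: k => [|k IH]; rewrite ?expr0 ?scale1r// iterS IH linearZ/= fw scalerA exprSr.
have c1 : c = 1.
  apply: (@pchar_unity_eq1 _ n); apply/eqP; rewrite -subr_eq0.
  have : (c ^+ (p ^ n) - 1) *: w = 0.
    by rewrite scalerBl -iterw unipX1 -[in (p ^ n)%N](addn0 n) Wpn// scale1r subrr.
  by move=> /eqP; rewrite scaler_eq0 (negPf w0) orbF.
(* An integer z is a natural number plus a multiple of p^n: the first part acts by a power of
   [unip 1], the second trivially on [W]. *)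
exists w => // z; have [z' zz'] : exists z', z - (z n)%:R = p%:R ^+ n * z'.
  by apply: padic_res_eqP; rewrite padic_res_nat padic_res_small.
rewrite -(subrK (z n)%:R z) zz' rmorphD/= -unipM repr_actM.
by rewrite -unipX1 iterw c1 expr1n scale1r Ww.
Qed.

(** Conjugation by diag(x, 1) with x a unit maps the unipotents with entry in Z_p to themselves, and
    the torus is commutative. *)
Lemma torus_stable_unip_fixed n (x : U) : padic_integer_units (val x) ->
  forall v, (unip_fixed v /\ forall y : U, padic_lattice n (val y - 1) -> Pi (torus y) v = v) ->
  unip_fixed (Pi (torus x) v) /\
    forall y : U, padic_lattice n (val y - 1) -> Pi (torus y) (Pi (torus x) v) = Pi (torus x) v.
Proof.
move=> [u uu ux] v [vN vT]; split=> [z|y yn].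
  rewrite -repr_actM unip_torus repr_actM -ux; congr (Pi _ _).
  by rewrite -rmorphV// -rmorphM vN.
by rewrite -repr_actM torusM funit_mulC -torusM repr_actM vT.
Qed.

(** Induction on j produces a torus-stable nonzero space [W] on which every unit with residue below
    j modulo p^n acts by a scalar. Only finitely many classes have to be treated, so j = p^n
    suffices. *)
Lemma torus_eigenvector v1 : smooth_repr Pi -> unip_fixed v1 -> v1 != 0 ->
  exists v, [/\ v != 0, unip_fixed v &
    forall x : U, padic_integer_units (val x) -> exists c, Pi (torus x) v = c *: v].
Proof.
move=> sm v1N v10; have [n0 n0fix] := smooth_fixes v1 sm.
(* A positive precision, so that the totient of p^n is p^n - p^n0. *)
pose n := n0.+1.
(* The second condition makes the units act on [W0] through their class modulo p^n. *)
pose W0 := [set v | unip_fixed v /\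
  forall y : U, padic_lattice n (val y - 1) -> Pi (torus y) v = v].
have main j : exists W : set V, [/\ is_subspace W, W `<=` W0,
    (forall x, padic_integer_units (val x) -> forall v, W v -> W (Pi (torus x) v)),
    (exists2 v, W v & v != 0) &
    forall (x : U) (u : Zp), u \is a GRing.unit -> padic_of_int u = val x ->
      (u n < j)%N -> exists c, forall v, W v -> Pi (torus x) v = c *: v].
  elim: j => [|j [W [Wsub WW0 Wst [w Ww w0] Weig]]].
    exists W0; split=> //.
    - split=> [|a v w [vN vT] [wN wT]]; first by split=> [z|y _]; rewrite linear0.
      by split=> [z|y yn]; rewrite linearP/= ?vN ?wN ?vT ?wT.
    - by move=> x xu v; apply: torus_stable_unip_fixed.
    - exists v1 => //; split=> // y yn; apply: n0fix; rewrite ?subrr; try exact: padic_lattice0.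
      by apply: padic_lattice_le yn.
  have [[x0 [u0 [u0u u0x u0j]]]|nex] := pselect (exists (x0 : U) (u0 : Zp),
    [/\ u0 \is a GRing.unit, padic_of_int u0 = val x0 & u0 n = j]); last first.
    exists W; split=> //; first by exists w.
    move=> x u uu ux; rewrite ltnS leq_eqVlt => /predU1P[uj|]; last exact: Weig.
    by exfalso; apply: nex; exists x, u.
  have x0u : padic_integer_units (val x0) by exists u0.
  (* This turns Euler's theorem, x0^totient(p^n) = 1 modulo p^n, into the relation that
     [frobenius_eigenvector] takes. *)
  have pn : (p ^ n = totient (p ^ n) + p ^ n0)%N.
    by rewrite /n totient_pfactor//= expnS -{1}(prednK (prime_gt0 p_pr)) mulSn addnC.
  have tot : iter (totient (p ^ n)) (Pi (torus x0)) w = w.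
    rewrite repr_iter torusX; apply: (WW0 _ Ww).2.
    rewrite funit_valX -u0x -rmorphXn -[1](rmorph1 (@padic_of_int p p_pr)) -rmorphB.
    have [z ->] : exists z, u0 ^+ totient (p ^ n) - 1 = p%:R ^+ n * z.
      apply: padic_res_eqP; rewrite padic_resX -[1]/(1%:R) padic_res_nat.
      by apply: Euler_exp_totient; exact: padic_unit_res_coprime.
    by apply/padic_latticeP; exists z.
  have w_iter : iter (p ^ n0.+1) (Pi (torus x0)) w = iter (p ^ n0) (Pi (torus x0)) w.
    by rewrite pn addnC iterD tot.
  have [c [w' [Ww' w'0 fw']]] :=
    frobenius_eigenvector p_pr Wsub (Wst _ x0u) Ww w0 w_iter.
  (* Shrink [W] to an eigenspace of x0, which is torus-stable by commutativity. Any x of the same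
     residue is x0 times a unit congruent to 1, so it acts by the same scalar. *)
  exists [set v | W v /\ Pi (torus x0) v = c *: v]; split.
  - split=> [|a v v' [Wv vc] [Wv' v'c]]; first by split; [exact: Wsub.1|rewrite linear0 scaler0].
    by split; [exact: Wsub.2|rewrite linearP/= vc v'c scalerDr !scalerA mulrC].
  - by move=> v [/WW0].
  - move=> x xu v [Wv vc]; split; first exact: Wst.
    by rewrite -repr_actM torusM funit_mulC -torusM repr_actM vc linearZ.
  - by exists w'.
  - move=> x u uu ux; rewrite ltnS leq_eqVlt => /predU1P[uj|].
      exists c => v [Wv <-].
      have -> : x = (x0 * (x0^-1 * x))%g by rewrite mulVKg.
      rewrite -torusM repr_actM; congr (Pi _ _).
      apply: (WW0 _ Wv).2; rewrite /= -ux -u0x -rmorphV//=.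
      have [z uz] : exists z, u - u0 = p%:R ^+ n * z by apply: padic_res_eqP; rewrite u0j.
      apply/padic_latticeP; exists (u0^-1 * z).
      rewrite -rmorphM -[1](rmorph1 (@padic_of_int p p_pr)) -rmorphB; congr padic_of_int.
      by rewrite mulrCA -uz mulrBr mulVr.
    by move=> /(Weig x u uu ux)[c' c'P]; exists c' => v [/c'P].
have [W [_ WW0 _ [v Wv v0] Weig]] := main (p ^ n)%N.
exists v; split=> //; first by have [] := WW0 _ Wv.
move=> x [u /= uu ux]; have [c cP] := Weig x u uu ux (padic_res_lt u n).
by exists c; apply: cP.
Qed.

End FixedVectors.

(** * Extending characters from the units *)

Section UnitPart.
Variables (p : nat) (p_pr : prime p).
Local Notation Zp := (padic_int p_pr).
Local Notation Qp := (padic p_pr).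
Local Notation U := (field_units Qp).
Implicit Types x y : U.

Lemma padic_integer_unitsM (a b : Qp) :
  padic_integer_units a -> padic_integer_units b -> padic_integer_units (a * b).
Proof.
move=> [u uu <-] [v vu <-]; exists (u * v); last by rewrite rmorphM.
by rewrite /= unitrM uu.
Qed.

Lemma padic_integer_unitsV (a : Qp) :
  padic_integer_units a -> padic_integer_units a^-1.
Proof. by move=> [u uu <-]; exists u^-1; rewrite /= ?unitrV// rmorphV. Qed.

Lemma padic_integer_units1 : padic_integer_units (1 : Qp).
Proof. by exists 1; [exact: unitr1|exact: rmorph1]. Qed.

Lemma padic_integer_units_lattice n (a : Qp) :
  padic_lattice n.+1 (a - 1) -> padic_integer_units a.
Proof.
move=> /padic_latticeP[z az]; exists (1 + p%:R ^+ n.+1 * z); last first.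
  by rewrite rmorphD rmorph1/= -az addrC subrK.
rewrite /= padic_int_unitE (@padic_eq_res _ _ _ 1 1 (p%:R ^+ n * z)); last first.
  by rewrite addrAC subrr add0r mulrA -exprS.
by rewrite -[1]/(1%:R) padic_res_nat modn_small// expn1 prime_gt1.
Qed.

Lemma unit_part_subproof x : exists y, padic_integer_units (val y) /\
  exists m n, val x * p%:R ^+ m = p%:R ^+ n * val y.
Proof.
have [m [n [u [uu xu]]]] := padic_decomp (valP x).
have u0 : padic_of_int u != 0.
  by rewrite padic_of_int_eq0; apply: contraTneq uu => ->; rewrite unitr0.
by exists (exist (fun y : Qp => y != 0) _ u0); split; [exists u|exists m, n].
Qed.

(** The projection of Q_p^x onto Z_p^x that kills p; composing with it extends a character of the
    units by sending p to 1. *)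
Definition unit_part x : U := sval (cid (unit_part_subproof x)).

Lemma unit_partP x : padic_integer_units (val (unit_part x)) /\
  exists m n, val x * p%:R ^+ m = p%:R ^+ n * val (unit_part x).
Proof. exact: (svalP (cid (unit_part_subproof x))). Qed.

Lemma unit_part_uniq x y m n : padic_integer_units (val y) ->
  val x * p%:R ^+ m = p%:R ^+ n * val y -> unit_part x = y.
Proof.
have [[u uu ux] [m' [n' xu]]] := unit_partP x.
move=> [v vu vy] xv; apply: val_inj; rewrite -ux -vy; congr padic_of_int.
apply: (@padic_unit_decomp_inj _ _ _ _ (n' + m) (n + m')) => //.
apply: padic_of_int_inj; rewrite !rmorphM !rmorphXn !rmorph_nat/= ux vy !exprD.
by rewrite -[LHS]mulrA [p%:R ^+ m * _]mulrC mulrA -xu [RHS]mulrAC -xv mulrAC.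
Qed.

Lemma unit_part_id x : padic_integer_units (val x) -> unit_part x = x.
Proof. by move=> xu; apply: (@unit_part_uniq _ _ 0 0) => //; rewrite mulr1 mul1r. Qed.

Lemma unit_partM : {morph unit_part : x y / (x * y)%g}.
Proof.
move=> x y; have [xu [m [n xm]]] := unit_partP x; have [yu [m' [n' ym]]] := unit_partP y.
apply: (@unit_part_uniq _ _ (m + m') (n + n')); first exact: padic_integer_unitsM.
by rewrite /= !exprD mulrACA xm ym mulrACA.
Qed.

(** Openness at 1 propagates by translation: if y is close to x, at a precision depending on x, then
    x^-1 y is close to 1. *)
Lemma smooth_characterP (E : fieldType)
    (s : {multiplicative U -> field_units E}%g) n :
  (forall x, padic_lattice n (val x - 1) -> s x = 1%g) -> smooth_character s.
Proof.
move=> s1; rewrite /smooth_character openE => x /= sx; apply/funit_nbhsP.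
have [m mP] := padic_scale_lattice (val x)^-1 n; exists m => y xy.
have -> : y = (x * (x^-1 * y))%g by rewrite mulVKg.
rewrite /= gmulfM sx s1 ?mulg1//=; move/mP: xy.
by rewrite mulrBr mulVf//; exact: (valP x).
Qed.

End UnitPart.

Lemma multiplicativeV (G H : groupType) (f : {multiplicative G -> H}%g) (x : G) :
  f (x^-1)%g = ((f x)^-1)%g.
Proof.
have f1 : f 1%g = 1%g by apply: (mulgI (f 1%g)); rewrite -gmulfM !mulg1.
by apply: (mulgI (f x)); rewrite -gmulfM !mulgV.
Qed.

Lemma borel_mx_decomp (F : fieldType) (a d : field_units F) b :
  borel_mx a b d =
  (borel_scalar d * (unip (b * (val d)^-1) * torus (a * d^-1)))%g.
Proof.
rewrite borel_scalarE /unip /torus !borel_mxM; apply: borel_mx_eq.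
- by rewrite mul1g funit_mulC mulgVK.
- rewrite /= !mulr0 mul0r mulr1 add0r addr0 mulrCA mulfV ?mulr1//.
  exact: (valP d).
- by rewrite !mulg1.
Qed.

(** * The characters sigma1 and sigma2, and the KZ-eigenvector *)

Section Characters.
Variables (p : nat) (p_pr : prime p) (E : fieldExtType 'F_p).
Variables (V : lmodType E) (Pi : representation (borel (padic p_pr)) V).
Local Notation Qp := (padic p_pr).
Local Notation U := (field_units Qp).

(** Scalars close to 1 lie in the open stabiliser of v, so smoothness passes from the representation
    to its central character. *)
Lemma central_character_trivial_near1 (w : U -> field_units E) (v : V) :
  smooth_repr Pi -> v != 0 ->
  (forall x v, Pi (borel_scalar x) v = \val (w x) *: v) ->
  exists n, forall x, padic_lattice n (val x - 1) -> w x = 1%g.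
Proof.
move=> sm v0 wP; have [n nfix] := smooth_fixes v sm; exists n => x xn.
apply: val_inj => /=; apply/eqP; rewrite -subr_eq0.
have : (\val (w x) - 1) *: v = 0.
  rewrite scalerBl scale1r -wP borel_scalarE nfix ?subrr//; exact: padic_lattice0.
by move/eqP; rewrite scaler_eq0 (negPf v0) orbF.
Qed.

Lemma torus_character (v : V) : v != 0 -> smooth_repr Pi ->
  (forall x : U, padic_integer_units (val x) -> exists c, Pi (torus x) v = c *: v) ->
  exists chi : {multiplicative U -> field_units E}%g,
    (forall x, padic_integer_units (val x) -> Pi (torus x) v = val (chi x) *: v) /\
    exists n, forall x, padic_lattice n (val x - 1) -> chi x = 1%g.
Proof.
move=> v0 sm eig.
have scale_inj (a b : E) : a *: v = b *: v -> a = b.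
  move=> /eqP; rewrite -subr_eq0 -scalerBl scaler_eq0 (negPf v0) orbF subr_eq0.
  by move/eqP.
have /choice[chi chiP] : forall x, exists c : field_units E,
    Pi (torus (unit_part x)) v = val c *: v.
  move=> x; have [c xc] := eig _ (unit_partP x).1.
  have c0 : c != 0.
    (* Group elements act injectively, so the eigenvalue is nonzero. *)
    apply: contra_neq v0 => c0; apply: (@repr_inj _ _ _ Pi (torus (unit_part x))).
    by rewrite xc c0 scale0r.
  by exists (exist (fun y : E => y != 0) c c0).
have chiM : {morph chi : x y / (x * y)%g}.
  move=> x y; apply: val_inj; apply: scale_inj; rewrite -chiP unit_partM -torusM.
  by rewrite repr_actM chiP linearZ/= chiP scalerA mulrC.
pose chi' : {multiplicative U -> field_units E}%g :=
  HB.pack chi (isMultiplicative.Build U (field_units E) chi chiM).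
exists chi'; split=> [x xu|]; first by rewrite -{1}(unit_part_id xu) chiP.
(* Precision at least 1 ensures that x is a unit, hence its own unit part. *)
have [n nfix] := smooth_fixes v sm; exists n.+1 => x xn; apply: val_inj.
apply: scale_inj; rewrite /= -chiP unit_part_id ?scale1r; last first.
  exact: padic_integer_units_lattice xn.
by apply: nfix; rewrite ?subrr; try exact: padic_lattice0; apply: padic_lattice_le xn.
Qed.

Lemma KZ_eigenvector :
  smooth_repr Pi -> irreducible_repr Pi -> admits_central_character Pi ->
  exists (s1 s2 : {multiplicative U -> field_units E}%g) (v : V),
    [/\ smooth_character s1, smooth_character s2, v != 0 &
        forall k, borel_KZ k -> Pi k v = tensor_character s1 s2 k *: v].
Proof.
move=> sm [[v0 v00] _] [w wP].
have [v1 v1N v10] := unip_fixed_neq0 sm v00.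
have [v [vn0 vN eig]] := torus_eigenvector sm v1N v10.
have [chi [chiP [n chin]]] := torus_character vn0 sm eig.
have [n' wn] := central_character_trivial_near1 sm vn0 wP.
(* A scalar acts through the product of the two characters, which must therefore be [w]. *)
pose s2 x := (w x * (chi x)^-1)%g.
have s2M : {morph s2 : x y / (x * y)%g}.
  move=> x y; apply: val_inj; rewrite /s2 !gmulfM /= -/(val (w x)).
  by rewrite invfM mulrACA.
pose s2' : {multiplicative U -> field_units E}%g :=
  HB.pack s2 (isMultiplicative.Build U (field_units E) s2 s2M).
exists chi, s2', v; split=> //; first exact: smooth_characterP chin.
  apply: (@smooth_characterP _ _ _ s2' (maxn n n')) => x xn /=.
  rewrite /s2 wn ?chin ?mul1g ?invg1//; apply: padic_lattice_le xn.
    by rewrite leq_maxl.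
  by rewrite leq_maxr.
have s12 x : val (chi x) * val (s2 x) = val (w x).
  by rewrite /s2 /= mulrCA mulfV ?mulr1//; exact: (valP (chi x)).
move=> _ [k [ka kd [b _ kb]] [_ [z _ <-] <-]].
rewrite repr_actM wP; transitivity (val (w z) *: Pi k v); first exact: linearZ.
have -> : Pi k v = (val (w (borel_d k)) * val (chi (borel_a k * (borel_d k)^-1)%g)) *: v.
  have ad : padic_integer_units (val (borel_a k * (borel_d k)^-1)%g).
    exact: (padic_integer_unitsM ka (padic_integer_unitsV kd)).
  have [d' d'u d'E] := padic_integer_unitsV kd.
  rewrite {1}(borel_mxE k) borel_mx_decomp 2!repr_actM wP chiP// linearZ/= -kb -d'E.
  by rewrite -rmorphM vN scalerA.
rewrite /tensor_character borel_aM borel_dM borel_scalarE borel_a_mx borel_d_mx.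
rewrite scalerA -[s2' _]/(s2 _) s2M !gmulfM.
have -> : chi (borel_d k)^-1%g = (chi (borel_d k))^-1%g by rewrite multiplicativeV.
rewrite -s12; congr (_ *: v).
have aux (cz s wd ca cd : E) : cz * s * (wd * (ca * cd)) = ca * cz * (wd * cd * s).
  by ring.
exact: aux.
Qed.

End Characters.

(** * The subgroup KZ and its cosets *)

Lemma borel_mxV (F : fieldType) (a d : field_units F) b :
  ((borel_mx a b d)^-1 = borel_mx a^-1 (- ((val a)^-1 * b * (val d)^-1)) d^-1)%g.
Proof.
apply: (mulgI (borel_mx a b d)); rewrite mulgV borel_mxM !mulgV borel_oneE.
apply: borel_mx_eq => //=; rewrite mulrN -mulrA mulVKf ?addNr//.
exact: (valP a).
Qed.

HB.instance Definition _ p (p_pr : prime p) :=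
  isPointed.Build (borel (padic p_pr)) 1%g.

Section KZ.
Variables (p : nat) (p_pr : prime p).
Local Notation Zp := (padic_int p_pr).
Local Notation Qp := (padic p_pr).
Local Notation B := (borel Qp).
Local Notation U := (field_units Qp).
Local Notation KZ := (@borel_KZ p p_pr).
Local Notation K := (@borel_K p p_pr).

Lemma borel_K_mx (a d : U) (b : Qp) : K (borel_mx a b d) <->
  [/\ padic_integer_units (val a), padic_integer_units (val d) & padic_integers b].
Proof. by rewrite /borel_K /mkset borel_a_mx borel_d_mx borel_b_mx. Qed.

Lemma padic_integer_units_int (a : Qp) : padic_integer_units a -> padic_integers a.
Proof. by move=> [u _ <-]; exists u. Qed.

Lemma padic_integersM (a b : Qp) :
  padic_integers a -> padic_integers b -> padic_integers (a * b).
Proof. by move=> [u _ <-] [v _ <-]; exists (u * v) => //; rewrite rmorphM. Qed.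

Lemma padic_integersD (a b : Qp) :
  padic_integers a -> padic_integers b -> padic_integers (a + b).
Proof. by move=> [u _ <-] [v _ <-]; exists (u + v) => //; rewrite rmorphD. Qed.

Lemma padic_integersN (a : Qp) : padic_integers a -> padic_integers (- a).
Proof. by move=> [u _ <-]; exists (- u) => //; rewrite rmorphN. Qed.

Lemma borel_KM g h : K g -> K h -> K (g * h)%g.
Proof.
rewrite (borel_mxE g) (borel_mxE h) borel_mxM => /borel_K_mx[ga gd gb] /borel_K_mx[ha hd hb].
apply/borel_K_mx; split.
- exact: (padic_integer_unitsM ga ha).
- exact: (padic_integer_unitsM gd hd).
- apply: padic_integersD.
    exact: (padic_integersM (padic_integer_units_int ga) hb).
  exact: (padic_integersM gb (padic_integer_units_int hd)).
Qed.

Lemma borel_KV g : K g -> K (g^-1)%g.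
Proof.
rewrite (borel_mxE g) borel_mxV => /borel_K_mx[ga gd gb].
have ga' := padic_integer_unitsV ga; have gd' := padic_integer_unitsV gd.
apply/borel_K_mx; split; [exact: ga'|exact: gd'|apply: padic_integersN].
apply: (padic_integersM _ (padic_integer_units_int gd')).
exact: (padic_integersM (padic_integer_units_int ga') gb).
Qed.

Lemma borel_K1 : K 1%g.
Proof.
rewrite borel_oneE; apply/borel_K_mx; split.
- exact: padic_integer_units1.
- exact: padic_integer_units1.
- by exists 0 => //; rewrite rmorph0.
Qed.

Lemma borel_scalarM (x y : U) :
  (borel_scalar x * borel_scalar y)%g = borel_scalar (x * y)%g.
Proof. by rewrite !borel_scalarE borel_mxM mulr0 mul0r addr0. Qed.

Lemma borel_scalarV (x : U) : ((borel_scalar x)^-1 = borel_scalar x^-1)%g.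
Proof. by rewrite !borel_scalarE borel_mxV mulr0 mul0r oppr0. Qed.

Lemma borel_scalar1 : borel_scalar (1%g : U) = 1%g.
Proof. by rewrite borel_scalarE borel_oneE. Qed.

Lemma borel_K_KZ : K `<=` KZ.
Proof.
move=> k kK; exists k => //; exists 1%g; last by rewrite mulg1.
by exists 1%g => //; exact: borel_scalar1.
Qed.

Lemma borel_scalar_KZ (x : U) : KZ (borel_scalar x).
Proof.
by exists 1%g; [exact: borel_K1|exists (borel_scalar x); [exists x|rewrite mul1g]].
Qed.

Lemma borel_KZM g h : KZ g -> KZ h -> KZ (g * h)%g.
Proof.
move=> [k kK [_ [x _ <-] <-]] [k' k'K [_ [x' _ <-] <-]].
exists (k * k')%g; first exact: borel_KM.
exists (borel_scalar (x * x')%g); first by exists (x * x')%g.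
rewrite -borel_scalarM -!mulgA; congr (_ * _)%g.
by rewrite !mulgA (borel_scalar_commute x k').
Qed.

Lemma borel_KZV g : KZ g -> KZ (g^-1)%g.
Proof.
move=> [k kK [_ [x _ <-] <-]]; exists (k^-1)%g; first exact: borel_KV.
exists (borel_scalar x^-1%g); first by exists (x^-1)%g.
by rewrite borel_scalar_commute invgM borel_scalarV.
Qed.

Lemma borel_KZ1 : KZ 1%g. Proof. exact: (borel_K_KZ borel_K1). Qed.

Lemma nbhs1_borel_K : nbhs (1%g : B) K.
Proof.
apply/borel_nbhsP; exists 1%N => h; rewrite (borel_mxE h) borel_oneE => hP.
apply/borel_K_mx; split.
- by have := hP 0 0; rewrite !mxE => /padic_integer_units_lattice.
- by have := hP 1 1; rewrite !mxE => /padic_integer_units_lattice.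
- by have := hP 0 1; rewrite !mxE /= subr0 => /padic_latticeP[z ->]; exists (p%:R ^+ 1 * z).
Qed.

(** * Compactness of K through ultrafilters *)

(** Either the fibre over the top value belongs to the ultrafilter, or its complement does and the
    bound drops by one. *)
Lemma ultra_bounded_fiber T (F : set_system T) (A : set T) (r : T -> nat) N :
  UltraFilter F -> F A -> (forall x, A x -> (r x < N)%N) ->
  exists k, F [set x | r x = k].
Proof.
move=> UF; elim: N A => [|N IH] A FA rN.
  by have [x /rN] := filter_ex FA.
have [FN|FN] := in_ultra_setVsetC [set x | r x = N] UF; first by exists N.
apply: (IH _ (filterI FA FN)) => x [/rN + /=].
by rewrite ltnS leq_eqVlt => /predU1P[].
Qed.

(** Each residue takes finitely many values, so it is constant on a member of F; members intersect,
    which makes the constants compatible. *)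
Lemma ultra_padic_limit T (F : set_system T) (f : T -> Zp) :
  UltraFilter F -> exists z : Zp, forall n, F [set x | f x n = z n].
Proof.
move=> UF; have /choice[k kP] : forall n, exists k, F [set x | f x n = k].
  move=> n; apply: (@ultra_bounded_fiber _ _ setT _ (p ^ n)) => [|x _].
    exact: filterT.
  exact: padic_res_lt.
have kmod n : (k n.+1 %% p ^ n = k n)%N.
  by have [x [/= <- <-]] := filter_ex (filterI (kP n.+1) (kP n)); exact: padic_resP.
by exists (PadicSeq kmod).
Qed.

(** A retraction onto Z_p, with junk value 0 elsewhere, so that matrix entries give functions on all
    of B with values in Z_p. *)
Lemma padic_int_part_ex : exists r : Qp -> Zp, forall z, r (padic_of_int z) = z.
Proof.
have /choice[r rP] : forall x : Qp, exists z, padic_integers x -> padic_of_int z = x.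
  move=> x; have [[z _ <-]|nx] := pselect (padic_integers x); first by exists z.
  by exists 0.
by exists r => z; apply: padic_of_int_inj; apply: rP; exists z.
Qed.

(** An ultrafilter containing K converges entry by entry. The diagonal limits stay units because
    being a unit is read off the residue modulo p. *)
Lemma borel_K_compact : compact K.
Proof.
rewrite compact_ultra => F UF FK; have [r rP] := padic_int_part_ex.
have [a aP] := ultra_padic_limit (fun g : B => r (val (borel_a g))) UF.
have [d dP] := ultra_padic_limit (fun g : B => r (val (borel_d g))) UF.
have [b bP] := ultra_padic_limit (fun g : B => r (borel_b g)) UF.
have au : a \is a GRing.unit.
  have [g [[[u uu ug] _ _] ga]] := filter_ex (filterI FK (aP 1%N)).
  by rewrite padic_int_unitE -ga -ug rP -padic_int_unitE.
have du : d \is a GRing.unit.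
  have [g [[_ [u uu ug] _] ga]] := filter_ex (filterI FK (dP 1%N)).
  by rewrite padic_int_unitE -ga -ug rP -padic_int_unitE.
have n0 (u : Zp) : u \is a GRing.unit -> padic_of_int u != 0.
  by move=> uu; rewrite padic_of_int_eq0; apply: contraTneq uu => ->; rewrite unitr0.
pose a' : U := exist (fun y : Qp => y != 0) _ (n0 a au).
pose d' : U := exist (fun y : Qp => y != 0) _ (n0 d du).
exists (borel_mx a' (padic_of_int b) d'); split.
  by apply/borel_K_mx; split; [exists a|exists d|exists b].
move=> A /borel_nbhsP[n nA].
apply: filterS (filterI FK (filterI (aP n) (filterI (dP n) (bP n)))).
move=> h [[[u uu uh] [v vu vh] [w _ wh]] [ha [hd hb]]]; apply: nA.
have latt (y z : Zp) : y n = z n -> padic_lattice n (padic_of_int y - padic_of_int z).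
  by move=> /padic_res_eqP[t yz]; apply/padic_latticeP; exists t; rewrite -rmorphB/= yz.
have {}ha : u n = a n by rewrite -(rP u) uh.
have {}hd : v n = d n by rewrite -(rP v) vh.
have {}hb : w n = b n by rewrite -(rP w) wh.
move=> i j; rewrite [h]borel_mxE -wh; elim/ord2P: i; elim/ord2P: j; rewrite !mxE /=.
- by move: uh => /= <-; exact: latt.
- exact: latt.
- by rewrite subrr; exact: padic_lattice0.
- by move: vh => /= <-; exact: latt.
Qed.

(** * Representatives of KZ\B and finiteness of supports *)

(** The choice depends only on the set KZ g, so a coset has a single representative and the range of
    this function indexes KZ\B. *)
Definition coset_rep (g : B) : B := xget 1%g [set h | KZ (h * g^-1)%g].

Lemma coset_repP g : KZ (coset_rep g * g^-1)%g.
Proof.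
apply: (@xgetPex _ 1%g [set h | KZ (h * g^-1)%g]); exists g => /=.
by rewrite mulgV; exact: borel_KZ1.
Qed.

Lemma coset_rep_eq g h : KZ (g * h^-1)%g <-> coset_rep g = coset_rep h.
Proof.
split=> [gh|e]; last first.
  have := borel_KZM (borel_KZV (coset_repP g)) (coset_repP h).
  by rewrite e invgM invgK -mulgA mulKg.
congr (xget 1%g _); apply/seteqP; split=> x /= xg.
  by have := borel_KZM xg gh; rewrite -mulgA mulKg.
by have := borel_KZM xg (borel_KZV gh); rewrite invgM invgK -mulgA mulKg.
Qed.

Lemma coset_rep_id g : coset_rep (coset_rep g) = coset_rep g.
Proof. by apply/coset_rep_eq; exact: coset_repP. Qed.

(** KZ contains the neighbourhood K of 1, and right translations are continuous. *)
Lemma coset_rep_open g : open [set h | coset_rep h = coset_rep g].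
Proof.
rewrite openE => h /= hg.
have : nbhs (h * h^-1)%g KZ.
  by rewrite mulgV; apply: filterS nbhs1_borel_K; exact: borel_K_KZ.
move=> /(@borel_mulr_continuous p p_pr h^-1%g h) hKZ.
apply: (@filterS _ (nbhs h) _ _ _ _ hKZ) => h' /=.
by rewrite -hg => /coset_rep_eq.
Qed.

Lemma compact_finite_cosets (C : set B) : compact C -> finite_set (coset_rep @` C).
Proof.
pose f (c : B) := [set h | coset_rep h = coset_rep c].
rewrite compact_cover => /(_ B C f) Cf.
have [|c Cc|D _ CD] := Cf; first by move=> c _; exact: coset_rep_open.
  by exists c.
have CD' : coset_rep @` C `<=` coset_rep @` [set` D].
  by move=> _ [c /CD[d Dd /= ->] <-]; exists d.
apply: sub_finite_set CD' _; apply: finite_image; exact: finite_fset.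
Qed.

(** Multiplying by a central element does not change the coset, so the cosets met by S are already
    met by a compact set. *)
Lemma compact_mod_center_finite_cosets (S : set B) : compact_mod_center S ->
  finite_set (range coset_rep `&` S).
Proof.
move=> [C /compact_finite_cosets finC SC]; apply: sub_finite_set finC.
move=> _ [[x _ <-] /SC[c Cc [_ [y _ <-] cz]]]; exists c => //.
rewrite -[RHS]coset_rep_id -cz; apply/coset_rep_eq.
rewrite invgM mulgA borel_scalarV borel_scalar_commute -mulgA.
rewrite mulgV mulg1; exact: borel_scalar_KZ.
Qed.

End KZ.

(** * Frobenius reciprocity *)

Lemma fsum_finite (I : choiceType) (V : zmodType) (A D : set I) (F : I -> V) :
  finite_set D -> D `<=` A -> (forall x, A x -> ~ D x -> F x = 0) ->
  \sum_(x \in A) F x = \sum_(x <- fset_set D) F x.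
Proof.
move=> Dfin DA F0; rewrite -(fsbig_finite _ _ Dfin); apply/esym.
by apply: fsbig_widen => // x [Ax Dx] /=; exact: F0.
Qed.

Section Frobenius.
Variables (p : nat) (p_pr : prime p) (E : fieldType).
Variables (V : lmodType E) (Pi : representation (borel (padic p_pr)) V).
Local Notation Qp := (padic p_pr).
Local Notation B := (borel Qp).
Local Notation U := (field_units Qp).
Local Notation KZ := (@borel_KZ p p_pr).
Variables (s1 s2 : {multiplicative U -> field_units E}%g) (v : V).
Local Notation reps := (range (@coset_rep p p_pr)).
Local Notation ind12 := (ind s1 s2).

Lemma tensor_characterM g h :
  tensor_character s1 s2 (g * h)%g = tensor_character s1 s2 g * tensor_character s1 s2 h.
Proof. by rewrite /tensor_character borel_aM borel_dM !gmulfM mulrACA. Qed.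

Lemma ind_KZ (f : ind12) k g : KZ k ->
  val f (k * g)%g = tensor_character s1 s2 k * val f g.
Proof. by move=> kK; have := valP f; rewrite inE => -[fK _]; exact: fK. Qed.

Lemma ind_finite_support (f : ind12) : finite_set (reps `&` [set g | val f g != 0]).
Proof.
by have := valP f; rewrite inE => -[_]; exact: compact_mod_center_finite_cosets.
Qed.

(** The term at g of the map which Frobenius reciprocity attaches to the vector v. *)
Definition frob_term (f : ind12) (g : B) : V := (val f g : E) *: Pi (g^-1)%g v.

Definition frob (f : ind12) : V := \sum_(x \in reps) frob_term f x.

Lemma frob_finite (f : ind12) D : finite_set D -> D `<=` reps ->
  reps `&` [set g | val f g != 0] `<=` D ->
  frob f = \sum_(x <- fset_set D) frob_term f x.
Proof.
move=> Dfin DA fD; apply: fsum_finite => // x Ax Dx.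
have [fx|fx] := eqVneq (val f x) 0; first by rewrite /frob_term fx scale0r.
by case: Dx; apply: fD.
Qed.

Lemma frob_linear : linear frob.
Proof.
move=> a f f'; pose S h := reps `&` [set g | val (h : ind12) g != 0].
(* A finite set of cosets carrying all three functions, over which the sums can be compared. *)
pose D := S (a *: f + f') `|` (S f `|` S f').
have Dfin : finite_set D by rewrite !finite_setU; split; [|split]; exact: ind_finite_support.
have DA : D `<=` reps by move=> x [|[]] [].
rewrite !(@frob_finite _ D) //.
- rewrite scaler_sumr -big_split; apply: eq_bigr => x _ /=.
  by rewrite /frob_term scalerA -scalerDl.
- by move=> x; right; right.
- by move=> x; right; left.
- by move=> x; left.
Qed.

Variable KZv : forall k, KZ k -> Pi k v = tensor_character s1 s2 k *: v.

(** The factor sigma(k) produced by f(k g) cancels against k^-1 v = sigma(k)^-1 v. *)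
Lemma frob_term_KZ f k g : KZ k -> frob_term f (k * g)%g = frob_term f g.
Proof.
move=> kK; rewrite /frob_term ind_KZ// invgM repr_actM mulrC -scalerA.
congr (_ *: _); rewrite -linearZ/=; congr (Pi _ _).
by rewrite -[RHS](repr_act1 Pi) -(mulVg k) repr_actM (KZv kK) linearZ.
Qed.

Lemma frob_term_rep f g : frob_term f (coset_rep g) = frob_term f g.
Proof. by rewrite -(frob_term_KZ f g (coset_repP g)) mulgVK. Qed.

(** Since f(x h) x^-1 v = h (f(x h) (x h)^-1 v), the claim is a change of variable: right
    translation by h permutes KZ\B. *)
Lemma frob_equivariant h f : frob (ind_act h f) = Pi h (frob f).
Proof.
have termE x : frob_term (ind_act h f) x = Pi h (frob_term f (coset_rep (x * h)%g)).
  by rewrite frob_term_rep /frob_term /= linearZ/= -repr_actM invgM mulgA mulgV mul1g.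
rewrite /frob (eq_fsbigr (fun x => Pi h (frob_term f (coset_rep (x * h)%g)))); last first.
  by move=> x _; exact: termE.
have bij : set_bij reps reps (fun x => coset_rep (x * h)%g).
  split.
  - by move=> x _; exists (x * h)%g.
  - move=> _ _ /set_mem[x _ <-] /set_mem[y _ <-] /coset_rep_eq.
    rewrite invgM mulgA mulgK => /coset_rep_eq; rewrite !coset_rep_id; exact.
  - move=> _ [y _ <-]; exists (coset_rep (y * h^-1)%g); first by exists (y * h^-1)%g.
    apply/coset_rep_eq.
    have -> : (coset_rep (y * h^-1) * h * y^-1 = coset_rep (y * h^-1) * (y * h^-1)^-1)%g.
      by rewrite invgM invgK mulgA.
    exact: coset_repP.
transitivity (\sum_(y \in reps) Pi h (frob_term f y)).
  exact/esym/(reindex_fsbig bij).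
(* Passing to a finite support lets [Pi h] move out of the sum. *)
pose D := reps `&` [set g | val f g != 0].
have Dfin : finite_set D := ind_finite_support f.
have DA : D `<=` reps by move=> x [].
rewrite (@fsum_finite _ _ _ D)//; last first.
  move=> x Ax Dx; have [fx|fx] := eqVneq (val f x) 0.
    by rewrite /frob_term fx scale0r linear0.
  by case: Dx.
by rewrite -/(frob f) (@frob_finite f D)// linear_sum.
Qed.

(** The function sigma extended by zero outside KZ; it is the preimage of v under [frob]. *)
Definition ind_base_fun (g : B) : E^o := if `[< KZ g >] then tensor_character s1 s2 g else 0.

Fact ind_base_subproof : ind_base_fun \in ind_pred s1 s2.
Proof.
rewrite inE; split=> [k g kK|].
  rewrite /ind_base_fun; case: asboolP => [kg|nkg].
    rewrite asboolT ?tensor_characterM//.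
    by rewrite -[g](mulKg k); apply: borel_KZM => //; exact: borel_KZV.
  by rewrite asboolF ?mulr0// => gK; apply: nkg; exact: borel_KZM.
exists (@borel_K p p_pr); first exact: borel_K_compact.
by move=> g /=; rewrite /ind_base_fun; case: asboolP => //; rewrite eqxx.
Qed.

Definition ind_base : ind12 := exist (fun f => f \in ind_pred s1 s2) _ ind_base_subproof.

Lemma frob_base : frob ind_base = v.
Proof.
have KZr : KZ (coset_rep 1%g) by have := coset_repP (1%g : B); rewrite invg1 mulg1.
rewrite (@frob_finite _ [set coset_rep 1%g]).
- rewrite fset_set1 big_seq_fset1 frob_term_rep /frob_term invg1 repr_act1 /=.
  rewrite /ind_base_fun asboolT; last exact: borel_KZ1.
  by rewrite -KZv ?repr_act1//; exact: borel_KZ1.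
- exact: finite_set1.
- by move=> _ ->; exists 1%g.
- move=> _ [[x _ <-] /=]; rewrite /ind_base_fun; case: asboolP => [|_]; last by rewrite eqxx.
  move=> xK _; rewrite -[LHS]coset_rep_id; apply/coset_rep_eq.
  by rewrite invg1 mulg1.
Qed.

(** The image of [frob] is a subrepresentation containing the nonzero vector v, so irreducibility
    makes it everything. *)
Lemma KZ_eigenvector_quotient : irreducible_repr Pi -> v != 0 ->
  quotient_repr Pi (ind_repr s1 s2).
Proof.
move=> [_ irr] v0.
pose phi : {linear ind12 -> V} :=
  HB.pack frob (GRing.isLinear.Build E ind12 V *:%R frob frob_linear).
exists phi; split; first exact: frob_equivariant.
have [|||rng|rng] := irr (range frob).
- by exists 0 => //; exact: (linear0 phi).
- by move=> a _ _ [f _ <-] [f' _ <-]; exists (a *: f + f') => //; exact: frob_linear.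
- by move=> g _ [f _ <-]; exists (ind_act g f) => //; exact: frob_equivariant.
- have : range frob v by exists ind_base => //; exact: frob_base.
  by rewrite rng => /= vE; rewrite vE eqxx in v0.
- by move=> w; have [f _ fw] : range frob w by [rewrite rng]; exists f.
Qed.

End Frobenius.

Theorem theorem1p2p3 (p : nat) (p_pr : prime p) (E : fieldExtType 'F_p)
    (V : lmodType E) (Pi : representation (borel (padic p_pr)) V) :
  smooth_repr Pi -> irreducible_repr Pi -> admits_central_character Pi ->
  exists sigma1 sigma2 :
      {multiplicative field_units (padic p_pr) -> field_units E},
    [/\ smooth_character sigma1, smooth_character sigma2 &
        quotient_repr Pi (ind_repr sigma1 sigma2)].
Proof.
move=> sm irr cc; have [s1 [s2 [v [sm1 sm2 v0 KZv]]]] := KZ_eigenvector sm irr cc.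
by exists s1, s2; split=> //; exact: KZ_eigenvector_quotient KZv irr v0.
Qed.
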